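(* Let $2\le k<n$ be integers, let $\mathcal D=\{d_1,\dots,d_k\}\subset\{0,1,\dots,n-1\}$ be a set of $k$ digits, and let $\alpha=\frac{\log k}{\log n}\in(0,1)$. For each $6<p<\infty$ let $c_{p,\alpha}>0$ be the exponent provided by Theorem 1.1 (the main decoupling theorem for AD-regular collections on the parabola). Then for every $\epsilon>0$ there is a constant $C=C(\epsilon,k,n,p)$ such that for every $i\ge1$, $$\mathrm{Dec}_p(C_i)\le C\,k^{\,i\left(\frac12-\frac3p-c_{p,\alpha}+\epsilon\right)}.$$
   Context: For $i\ge1$, $C_i=\{\sum_{j=1}^i a_jn^{-j}: a_j\in\mathcal D\}$ and $\mathcal I_i$ is the collection of the $k^i$ intervals $[c,c+n^{-i}]$, $c\in C_i$. For $I\in\mathcal I_i$ let $\theta_I=\{(x,x^2+t): x\in I,\ |t|\le n^{-2i}\}$. $\mathrm{Dec}_p(C_i)$ is the smallest constant such that $$\Big\|\sum_{I\in\mathcal I_i}F_{\theta_I}\Big\|_{L^p(\mathbb R^2)}\le \mathrm{Dec}_p(C_i)\Big(\sum_{I\in\mathcal I_i}\|F_{\theta_I}\|_{L^p(\mathbb R^2)}^2\Big)^{1/2}$$ for all functions $F_{\theta_I}:\mathbb R^2\to\mathbb C$ with $\operatorname{supp}\widehat{F_{\theta_I}}\subset\theta_I$. Theorem 1.1 (main theorem): for $\alpha\in(0,1)$ and $6<p<\infty$ there is $c_{p,\alpha}>0$ such that for all $C_{AD}\ge1,\epsilon>0$, all $R\ge 1$, all $(\alpha,R^{1/2},C_{AD})$-AD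 regular collections $\mathcal I$ and all $F$ with $\widehat F$ supported in $\mathcal N_{1/R}(\mathcal I)$, $\|F\|_{L^p}\lesssim_{\epsilon,C_{AD},p,\alpha}R^\epsilon(\#\Theta(\mathcal I))^{\frac12-\frac3p-c_{p,\alpha}}(\sum_\theta\|F_\theta\|_{L^p}^2)^{1/2}$. Here a collection $\mathcal I_R$ of pairwise disjoint length-$R^{-1}$ intervals in $[-1,1]$ is $(\alpha,R,C_{AD})$-AD regular if every interval $J$ with $2/R\le|J|\le4$ centered at a point of $\bigcup\mathcal I_R$ contains between $C_{AD}^{-1}(|J|R)^\alpha$ and $C_{AD}(|J|R)^\alpha$ intervals of $\mathcal I_R$; $\mathcal N_\delta(\mathcal I)=\{(x,x^2+t):x\in\bigcup\mathcal I,|t|\le\delta\}$; $\Theta(\mathcal I)$ consists of the regions $\{(x,x^2+t):x\in I,|t|\le1/R\}$, $I\in\mathcal I$; and $\widehat{F_\theta}=\widehat F 1_\theta$. *)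

(* Defs.v *)
From HB Require Import structures.
From mathcomp Require Import all_boot all_order all_algebra.
From mathcomp Require Import all_classical all_reals all_analysis.
Set Implicit Arguments. Unset Strict Implicit. Unset Printing Implicit Defensive.
Import Order.TTheory GRing.Theory Num.Theory.
Import numFieldNormedType.Exports.
Local Open Scope classical_set_scope.
Local Open Scope ring_scope.

Section Defs.
Variable R : realType.

Definition leb2 := (@lebesgue_measure R \x @lebesgue_measure R)%E.

(* complex numbers are represented as pairs (real part, imaginary part) *)
Definition cnorm (z : R * R) : R := Num.sqrt (z.1 ^+ 2 + z.2 ^+ 2).

Definition pnorm (p : R) (F : R * R -> R * R) : \bar R :=
  Lnorm leb2 p%:E (fun x => (cnorm (F x))%:E).

Definition cintegrable (F : R * R -> R * R) : Prop :=
  leb2.-integrable setT (fun x => ((F x).1)%:E) /\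
  leb2.-integrable setT (fun x => ((F x).2)%:E).

(* fourier s F xi = \int F(x) e^{2 pi i s x.xi} dx ; s = -1: Fourier
   transform, s = 1: inverse Fourier transform *)
Definition fourier (s : R) (F : R * R -> R * R) (xi : R * R) : R * R :=
  let ph := fun x : R * R => s * (2 * pi * (x.1 * xi.1 + x.2 * xi.2)) in
  (Rintegral leb2 setT (fun x => (F x).1 * cos (ph x) - (F x).2 * sin (ph x)),
   Rintegral leb2 setT (fun x => (F x).1 * sin (ph x) + (F x).2 * cos (ph x))).

Definition ft := fourier (-1).
Definition ift := fourier 1.

Definition fsupp_in (F : R * R -> R * R) (S : set (R * R)) : Prop :=
  forall xi, ~ S xi -> ft F xi = (0, 0).

Definition parab_nbhd (A : set R) (delta : R) : set (R * R) :=
  [set z | exists x t, A x /\ `|t| <= delta /\ z = (x, x ^+ 2 + t)].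

Definition digit_words (n : nat) (D : {set 'I_n}) (i : nat)
  : {set {ffun 'I_i -> 'I_n}} := [set a : {ffun 'I_i -> 'I_n} | [forall j, a j \in D]].

Definition cpt (n i : nat) (a : {ffun 'I_i -> 'I_n}) : R :=
  \sum_(j < i) ((a j)%:R / (n%:R ^+ j.+1)).

Definition theta (n i : nat) (a : {ffun 'I_i -> 'I_n}) : set (R * R) :=
  parab_nbhd `[cpt a, cpt a + (n%:R ^+ i)^-1] (n%:R ^+ (2 * i))^-1.

Definition DecSet (p : R) (n : nat) (D : {set 'I_n}) (i : nat) : set R :=
  [set B : R | 0 <= B /\
    forall F : {ffun 'I_i -> 'I_n} -> (R * R -> R * R),
      (forall a, a \in digit_words D i -> cintegrable (F a) /\ fsupp_in (F a) (theta a)) ->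
      (pnorm p (fun x => ((\sum_(a in digit_words D i) (F a x).1)%R,
                          (\sum_(a in digit_words D i) (F a x).2)%R))
       <= B%:E * poweR (\sum_(a in digit_words D i) (pnorm p (F a) * pnorm p (F a))) 2^-1)%E].

Definition Dec (p : R) (n : nat) (D : {set 'I_n}) (i : nat) : \bar R :=
  ereal_inf [set B%:E | B in DecSet p D i].

(* A collection of pairwise disjoint closed intervals [a, a + Rr^-1] in [-1,1],
   given by the (distinct) left endpoints s, is (alpha, Rr, Cad)-AD regular *)
Definition AD_regular (alpha Rr Cad : R) (s : seq R) : Prop :=
  let del := Rr^-1 in
  [/\ uniq s,
      (forall a, a \in s -> -1 <= a /\ a + del <= 1),
      (forall a b, a \in s -> b \in s -> a != b -> del < `|a - b|) &
      (forall x L, (exists2 a, a \in s & a <= x <= a + del) -> 2 / Rr <= L <= 4 ->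
        let m := (size [seq a <- s | (x - L / 2 <= a) && (a + del <= x + L / 2)])%:R in
        Cad^-1 * (L * Rr) `^ alpha <= m /\ m <= Cad * (L * Rr) `^ alpha)].

Definition union_intervals (s : seq R) (del : R) : set R :=
  [set x | exists2 a, a \in s & a <= x <= a + del].

Definition Fpiece (F : R * R -> R * R) (th : set (R * R)) : R * R -> R * R :=
  ift (fun xi => (\1_th xi * (ft F xi).1, \1_th xi * (ft F xi).2)).

Definition Thm11 (p alpha c : R) : Prop :=
  forall Cad eps : R, 1 <= Cad -> 0 < eps ->
  exists K : R, forall (Rr : R) (s : seq R) (F : R * R -> R * R),
    1 <= Rr -> AD_regular alpha (Num.sqrt Rr) Cad s ->
    cintegrable F ->
    fsupp_in F (parab_nbhd (union_intervals s (Num.sqrt Rr)^-1) Rr^-1) ->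
    (pnorm p F <= (K * Rr `^ eps * (size s)%:R `^ (2^-1 - 3 / p - c))%:E *
       poweR (\sum_(a <- s)
          (pnorm p (Fpiece F (parab_nbhd `[a, (a + (Num.sqrt Rr)^-1)%R] Rr^-1))
           * pnorm p (Fpiece F (parab_nbhd `[a, (a + (Num.sqrt Rr)^-1)%R] Rr^-1)))) 2^-1)%E.

End Defs.

(* Main.v *)
Require Import Defs.
From HB Require Import structures.
From mathcomp Require Import all_boot all_order all_algebra.
From mathcomp Require Import all_classical all_reals all_analysis.
From mathcomp Require Import measurable_realfun.
From mathcomp Require Import ring lra zify.
Set Implicit Arguments. Unset Strict Implicit. Unset Printing Implicit Defensive.
Import Order.TTheory GRing.Theory Num.Theory.
Import numFieldNormedType.Exports.
Local Open Scope classical_set_scope.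
Local Open Scope ring_scope.

(** The intervals of level [i] may share endpoints, so they are split into the
    [k] classes of words with a given last digit.  Within a class the left
    endpoints are [n * n^-i]-separated, and the class is AD regular with
    constant [k^3]: the number of words whose code has a prescribed quotient by
    [n^l] is at most [k^l], and exactly of that order around a word.  Theorem 1.1
    then applies to the sum of the [F_a] over each class, and Minkowski's
    inequality adds up the [k] classes.

    Theorem 1.1 bounds the norm by the pieces [ift (1_theta * ft F)], which here
    are [ift (ft F_a)].  Instead of Fourier inversion, only
    [||ift (ft F_a)||_p <= A ||F_a||_p] is proved.  Since [ft F_a] lives in
    [[-2,2]^2], it can be multiplied by a product of two trapezoids equal to [1]
    there; by Fubini [ift (ft F_a)] is then [F_a] convolved with the inverse
    transform of that product, which is dominated by a multiple of
    [1 / ((1+u^2)(1+v^2))], and Schur's test concludes. *)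

(** * AD regularity of digit classes *)

Section Codes.
Local Open Scope nat_scope.
Variables (n : nat) (ds : seq nat).

(** For [ds] the digits of [D], these are the numerators over $n^i$ of the points of $C_i$. The
    newest digit takes the units place, so one division by [n] undoes one step of the recursion. *)
Fixpoint codes (i : nat) : seq nat :=
  if i is j.+1 then [seq w * n + d | w <- codes j, d <- ds] else [:: 0].

Lemma size_codes i : size (codes i) = size ds ^ i.
Proof. by elim: i => //= i IH; rewrite size_allpairs IH expnSr. Qed.

Hypotheses (ds_lt : {in ds, forall d, d < n}) (ds_uniq : uniq ds) (n_gt0 : 0 < n) (ds_gt0 : 0 < size ds).

Lemma modn_code w d : d < n -> (w * n + d) %% n = d.
Proof. by move=> dn; rewrite modnMDl modn_small. Qed.

Lemma divn_code w d : d < n -> (w * n + d) %/ n = w.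
Proof. by move=> dn; rewrite divnMDl// divn_small// addn0. Qed.

Lemma uniq_codes i : uniq (codes i).
Proof.
elim: i => //= i IH; apply: allpairs_uniq => // -[w d] [w' d'].
move=> /allpairsP[[a b] /= [_ bd [-> ->]]] /allpairsP[[a' b'] /= [_ bd' [-> ->]]] eq.
have := congr1 (modn^~ n) eq; have := congr1 (divn^~ n) eq.
by rewrite !modn_code ?divn_code ?ds_lt// => -> ->.
Qed.

Lemma codes_lt i w : w \in codes i -> w < n ^ i.
Proof.
elim: i w => [|i IH] w /=; first by rewrite inE => /eqP ->.
move=> /allpairsP[[a b] /= [/IH ai /ds_lt bd ->]].
by rewrite expnSr (leq_trans (n := a.+1 * n))// ?leq_mul// mulSn addnC ltn_add2r.
Qed.

(** Quotient and remainder by [n] recover the prefix and the last digit, which vary independently;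
    hence the product. *)
Lemma count_codesS (b c : pred nat) i :
  count (fun v => b (v %/ n) && c (v %% n)) (codes i.+1) = count b (codes i) * count c ds.
Proof.
rewrite /=; elim: (codes i) => //= w s IH; rewrite count_cat IH mulnDl; congr (_ + _).
rewrite count_map.
have -> : count (preim (fun d => w * n + d) (fun v => b (v %/ n) && c (v %% n))) ds =
    count (fun d => b w && c d) ds.
  by apply: eq_in_count => d dd /=; rewrite divn_code ?modn_code ?ds_lt.
by case: (b w); rewrite ?mul1n// count_pred0.
Qed.

(** Fixing the quotient by [n ^ l] leaves at most the last [l] digits free. The induction peels off
    the units digit; if [i] runs out first, only the single empty code remains. *)
Lemma count_codes_le l i q : count (fun v => v %/ n ^ l == q) (codes i) <= size ds ^ l.
Proof.
elim: l i => [|l IH] [|i].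
- by rewrite /= divn1; case: eqP.
- under eq_count do rewrite expn0 divn1.
  by rewrite expn0 count_uniq_mem ?uniq_codes// leq_b1.
- by rewrite /= addn0 (leq_trans (leq_b1 _))// expn_gt0 ds_gt0.
- have -> : count (fun v => v %/ n ^ l.+1 == q) (codes i.+1) =
      count (fun v => (v %/ n) %/ n ^ l == q) (codes i.+1).
    by apply: eq_count => v /=; rewrite expnS divnMA.
  have := count_codesS (fun w => w %/ n ^ l == q) predT i.
  rewrite count_predT; under eq_count do rewrite andbT.
  by move=> ->; rewrite expnSr leq_mul2r IH orbT.
Qed.

(** The last [l] digits can be changed without affecting the quotient, and [l <= i] ensures that
    there are that many. *)
Lemma count_codes_ge l i v0 : l <= i -> v0 \in codes i ->
  size ds ^ l <= count (fun v => v %/ n ^ l == v0 %/ n ^ l) (codes i).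
Proof.
elim: l i v0 => [|l IH] i v0.
  move=> _ vi; under eq_count do rewrite expn0 !divn1.
  by rewrite expn0 count_uniq_mem ?uniq_codes// vi.
case: i => // i li /allpairsP[[w d] /= [wi dd ->]].
have -> : count (fun v => v %/ n ^ l.+1 == (w * n + d) %/ n ^ l.+1) (codes i.+1) =
    count (fun v => (v %/ n) %/ n ^ l == w %/ n ^ l) (codes i.+1).
  by apply: eq_count => v /=; rewrite expnS !divnMA divn_code ?ds_lt.
have := count_codesS (fun v => v %/ n ^ l == w %/ n ^ l) predT i.
rewrite count_predT; under eq_count do rewrite andbT.
by move=> ->; rewrite expnSr leq_mul2r IH ?orbT.
Qed.

(** With the units digit frozen as well, [l.-1] digits stay free. The truncated predecessor also
    handles [l = 0], where [v0] alone is counted. *)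
Lemma count_codes_class_ge l i v0 : l <= i.+1 -> v0 \in codes i.+1 ->
  size ds ^ l.-1 <= count (fun v => (v %/ n ^ l == v0 %/ n ^ l) && (v %% n == v0 %% n)) (codes i.+1).
Proof.
move=> li vi; case: l li => [|l] li.
  rewrite expn0 -has_count; apply/hasP; exists v0 => //.
  by rewrite !eqxx.
move: vi => /allpairsP[[w d] /= [wi dd ->]].
rewrite modn_code ?ds_lt//.
have -> : count (fun v => (v %/ n ^ l.+1 == (w * n + d) %/ n ^ l.+1) && (v %% n == d)) (codes i.+1) =
    count (fun v => ((v %/ n) %/ n ^ l == w %/ n ^ l) && (v %% n == d)) (codes i.+1).
  by apply: eq_count => v /=; rewrite expnS !divnMA divn_code ?ds_lt.
rewrite (count_codesS (fun v => v %/ n ^ l == w %/ n ^ l) (fun e => e == d)).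
rewrite (_ : count (fun e => e == d) ds = 1); last by rewrite -/(count_mem d ds) count_uniq_mem// dd.
by rewrite muln1 count_codes_ge.
Qed.

End Codes.

(** * Digit words as base-[n] integers *)

Section Words.
Variables (R : realType) (n : nat) (D : {set 'I_n}).

Definition code i (a : {ffun 'I_i -> 'I_n}) : nat := (\sum_(j < i) a j * n ^ (i - j.+1))%N.

Definition digits : seq nat := [seq val d | d <- enum D].

Definition prefix_word i (a : {ffun 'I_i.+1 -> 'I_n}) : {ffun 'I_i -> 'I_n} :=
  [ffun j => a (widen_ord (leqnSn i) j)].

Lemma code_recr i (a : {ffun 'I_i.+1 -> 'I_n}) :
  code a = (code (prefix_word a) * n + a ord_max)%N.
Proof.
rewrite /code big_ord_recr/= subnn expn0 muln1; congr addn.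
rewrite big_distrl/=; apply: eq_bigr => j _; rewrite ffunE -mulnA -expnSr.
by rewrite subSn// ltn_ord.
Qed.

Lemma cpt_code i (a : {ffun 'I_i -> 'I_n}) : (0 < n)%N -> cpt R a = (code a)%:R / n%:R ^+ i.
Proof.
move=> n0; rewrite /cpt /code natr_sum mulr_suml; apply: eq_bigr => j _.
rewrite natrM natrX -mulrA; congr (_ * _).
have n0' : n%:R != 0 :> R by rewrite pnatr_eq0 -lt0n.
have -> : n%:R ^+ i = n%:R ^+ (i - j.+1) * n%:R ^+ j.+1 :> R.
  by rewrite -exprD subnK.
by rewrite invfM mulrA mulfV ?mul1r// expf_neq0.
Qed.

Lemma code_inj i : (0 < n)%N -> injective (@code i).
Proof.
move=> n0; elim: i => [|i IH] a b.
  by move=> _; apply/ffunP => -[].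
rewrite !code_recr => ab.
have am : a ord_max = b ord_max.
  by have := congr1 (modn^~ n) ab; rewrite !modn_code// => /val_inj.
have pab : prefix_word a = prefix_word b.
  by apply: IH; have := congr1 (divn^~ n) ab; rewrite !divn_code.
apply/ffunP => j; case: (ltnP j i) => ji.
  have := congr1 (fun f : {ffun 'I_i -> 'I_n} => f (Ordinal ji)) pab.
  by rewrite /= !ffunE; congr (_ = _); congr (_ _); apply: val_inj.
have -> // : j = ord_max by apply: val_inj => /=; apply/eqP; rewrite eqn_leq ji -ltnS ltn_ord.
Qed.

Lemma digits_lt : {in digits, forall d, (d < n)%N}.
Proof. by move=> _ /mapP[d _ ->]; exact: ltn_ord. Qed.

Lemma uniq_digits : uniq digits.
Proof. by rewrite map_inj_uniq ?enum_uniq//; exact: val_inj. Qed.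

Lemma size_digits : size digits = #|D|.
Proof. by rewrite size_map cardE. Qed.

Lemma mem_codes i (a : {ffun 'I_i -> 'I_n}) :
  a \in digit_words D i -> code a \in codes n digits i.
Proof.
elim: i a => [|i IH] a; first by rewrite /code big_ord0 inE.
rewrite inE => /forallP aD; rewrite code_recr; apply/allpairsP.
exists (code (prefix_word a), val (a ord_max)); split => //=.
  by apply: IH; rewrite inE; apply/forallP => j; rewrite ffunE.
by apply/mapP; exists (a ord_max) => //; rewrite mem_enum.
Qed.

Lemma card_digit_words i : #|digit_words D i| = (#|D| ^ i)%N.
Proof.
rewrite -[in RHS](card_ord i) -card_ffun_on.
by apply: eq_card => a; rewrite inE; apply/forallP/ffun_onP.
Qed.

(** One inclusion goes digit by digit; both lists are duplicate-free of size [#|D| ^ i], so they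
    agree up to order. *)
Lemma perm_codes i : (0 < n)%N ->
  perm_eq [seq code a | a <- enum (digit_words D i)] (codes n digits i).
Proof.
move=> n0.
have u : uniq [seq code a | a <- enum (digit_words D i)].
  by rewrite map_inj_uniq ?enum_uniq//; exact: code_inj.
have sub : {subset [seq code a | a <- enum (digit_words D i)] <= codes n digits i}.
  by move=> _ /mapP[a + ->]; rewrite mem_enum => /mem_codes.
apply: uniq_perm => //; first by apply: uniq_codes => //; [exact: digits_lt|exact: uniq_digits].
have [] := uniq_min_size u sub; rewrite ?size_codes ?size_map -?cardE ?card_digit_words ?size_digits//.
Qed.

Lemma code_mod i (a : {ffun 'I_i.+1 -> 'I_n}) : (code a %% n)%N = a ord_max.
Proof. by rewrite code_recr modn_code. Qed.

End Words.

(** * Counting the intervals of a digit class in a window *)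

(** This is $n^\alpha=k$; it turns the regularity bounds into comparisons of powers of [k]. *)
Lemma powR_dim (R : realType) (k n l : nat) : (1 < k)%N -> (1 < n)%N ->
  ((n ^ l)%:R : R) `^ (ln (k%:R : R) / ln (n%:R : R)) = (k ^ l)%:R.
Proof.
move=> k1 n1.
have n0 : (0 : R) < n%:R by rewrite ltr0n ltnW.
have k0 : (0 : R) < k%:R by rewrite ltr0n ltnW.
have lnn : ln (n%:R : R) != 0 by rewrite gt_eqF// ln_gt0// ltr1n.
rewrite !natrX -[n%:R ^+ l]powR_mulrn ?ltW// -powRrM.
rewrite /powR gt_eqF//.
by rewrite -mulrA divfK// expRM_natl lnK ?posrE.
Qed.

Lemma trunc_log_real (R : realType) (n : nat) (x : R) : (1 < n)%N -> 1 <= x ->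
  exists l : nat, (n ^ l)%:R <= x < (n ^ l.+1)%:R.
Proof.
move=> n1 x1.
have x0 : 0 <= x by exact: le_trans x1.
have t1 : (1 <= Num.truncn x)%N by rewrite truncn_ge_nat.
have /andP[ex eS] := trunc_log_bounds n1 t1.
exists (trunc_log n (Num.truncn x)); apply/andP; split.
  by rewrite -truncn_ge_nat.
by apply: (lt_le_trans (truncnS_gt x)); rewrite ler_nat.
Qed.

Lemma divn_window (M a v : nat) : (0 < M)%N -> (a <= v < a + M)%N ->
  (v %/ M == a %/ M)%N || (v %/ M == (a %/ M).+1)%N.
Proof.
move=> M0 /andP[av vaM].
have h1 := leq_div2r M av.
have h2 : (v %/ M <= (a + M) %/ M)%N by rewrite leq_div2r// ltnW.
move: h2; rewrite divnDr// divnn M0 addn1; lia.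
Qed.

Lemma divn_eq_dist (M u v : nat) : (0 < M)%N -> (u %/ M = v %/ M)%N -> (u < v + M)%N.
Proof.
move=> M0 uv; rewrite {1}(divn_eq u M) uv {2}(divn_eq v M) -addnA ltn_add2l.
by rewrite (leq_trans (ltn_pmod u M0))// leq_addl.
Qed.

Lemma AD_regular_class (R : realType) (n k i d : nat) (ds cs : seq nat) :
  (1 < k)%N -> (k < n)%N -> size ds = k -> uniq ds -> {in ds, forall e, (e < n)%N} ->
  perm_eq cs [seq v <- codes n ds i.+1 | (v %% n == d)%N] ->
  AD_regular (ln (k%:R : R) / ln (n%:R : R)) ((n ^ i.+1)%:R) (k ^ 3)%:R
    [seq v%:R / (n ^ i.+1)%:R | v <- cs].
Proof.
move=> k1 kn sds uds dsn cs_perm.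
set N := (n ^ i.+1)%N; set al := ln _ / ln _.
have n1 : (1 < n)%N by exact: ltn_trans kn.
have n0 : (0 < n)%N by exact: ltnW.
have N0 : (0 < N)%N by rewrite expn_gt0 n0.
have N0R : (0 : R) < N%:R by rewrite ltr0n.
have ds0 : (0 < size ds)%N by rewrite sds ltnW.
have csE v : v \in cs -> v \in codes n ds i.+1 /\ (v %% n = d)%N.
  by rewrite (perm_mem cs_perm) mem_filter => /andP[/eqP ? ?].
have ucs : uniq cs by rewrite (perm_uniq cs_perm) filter_uniq// uniq_codes.
have al0 : 0 <= al by rewrite divr_ge0// ln_ge0// ler1n ltnW.
have k3 : (2 <= k ^ 3)%N by rewrite (leq_trans k1)// -{1}(expn1 k) leq_pexp2l// ltnW.
have inj : injective (fun v : nat => v%:R / N%:R : R).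
  move=> u v /(congr1 (fun x => x * N%:R)); rewrite !divfK ?gt_eqF// => /eqP.
  by rewrite eqr_nat => /eqP.
split.
- by rewrite map_inj_uniq.
- move=> _ /mapP[v /csE[vc _] ->]; have vN := codes_lt dsn vc; split.
    by rewrite (@le_trans _ _ 0)// ?oppr_le0// divr_ge0// ler0n.
  by rewrite -[X in _ + X]mul1r -mulrDl ler_pdivrMr// mul1r natr1 ler_nat.
- move=> _ _ /mapP[u uc ->] /mapP[v vc ->] uv.
  have [_ ud] := csE _ uc; have [_ vd] := csE _ vc.
  have {}uv : u != v by apply: contraNneq uv => ->.
  wlog : u v uc vc ud vd uv / (v < u)%N.
    move=> h; case: (ltngtP v u) => [|vu|vu]; first exact: h.
    - by rewrite distrC; apply: h => //; rewrite eq_sym.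
    - by rewrite vu eqxx in uv.
  (* Equal last digits make [u - v] a positive multiple of [n], hence at least 2, so the gap
     strictly exceeds one interval length. *)
  move=> vu; have vnu : (v + n <= u)%N.
    have : (v %/ n < u %/ n)%N.
      rewrite ltnNge; apply/negP => h.
      by move: vu; rewrite (divn_eq u n) (divn_eq v n) ud vd ltn_add2r ltn_mul2r n0/= ltnNge h.
    move=> h; rewrite (divn_eq u n) (divn_eq v n) ud vd addnAC leq_add2r -mulSnr leq_mul2r h.
    by rewrite orbT.
  rewrite -mulrBl ger0_norm; last by rewrite divr_ge0// subr_ge0 ler_nat ltnW.
  rewrite -[ltLHS]mul1r ltr_pM2r ?invr_gt0// ltrBrDr nat1r ltr_nat.
  by rewrite (leq_trans _ vnu)// -[(v.+2)%N]addn2 leq_add2l.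
move=> x L [_ /mapP[v0 v0c ->] /andP[xv0 xv1]] /andP[L2 L4] /=.
have [v0codes v0d] := csE _ v0c.
rewrite size_filter count_map (permP cs_perm) count_filter.
set P := predI _ _.
pose y := x * N%:R; pose La := L * N%:R.
have PE v : P v = [&& (y - La / 2 <= v%:R), (v%:R + 1 <= y + La / 2) & (v %% n == d)%N].
  have NN : N%:R != 0 :> R by rewrite gt_eqF.
  rewrite /P/= -andbA /y /La; congr [&& _, _ & _].
    by rewrite -(ler_pM2r N0R) divfK// mulrBl mulrAC.
  by rewrite -(ler_pM2r N0R) !mulrDl divfK// mulVf// [L / 2 * _]mulrAC.
have y0 : v0%:R <= y by rewrite /y -ler_pdivrMr.
have y1 : y <= v0%:R + 1.
  by rewrite /y -ler_pdivlMr// mulrDl mul1r.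
have La2 : 2 <= La by rewrite /La -ler_pdivrMr.
have La4 : La <= 4 * N%:R by rewrite /La ler_pM2r.
split.
(* Lower bound. The block of length [n ^ l] around [v0] fits in the window, because the half-length
   is at least [n ^ l] and [y] lies between [v0] and [v0 + 1]. *)
- have [l /andP[l1 l2]] : exists l : nat, (n ^ l)%:R <= La / 2 < (n ^ l.+1)%:R.
    by apply: trunc_log_real => //; lra.
  have li : (l <= i.+1)%N.
    rewrite -ltnS -(ltn_exp2l _ _ n1) -(ltr_nat R) (le_lt_trans l1)//.
    rewrite (@le_lt_trans _ _ (2 * N%:R))//; first lra.
    by rewrite expnS natrM ltr_pM2r// ltr_nat (leq_ltn_trans k1).
  have cge : (k ^ l.-1 <= count P (codes n ds i.+1))%N.
    have := count_codes_class_ge dsn uds n0 li v0codes; rewrite sds.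
    move=> /leq_trans; apply.
    apply: sub_count => v vP; rewrite PE; move: vP => /andP[/eqP vl /eqP vn].
    rewrite vn v0d eqxx andbT.
    have M0 : (0 < n ^ l)%N by rewrite expn_gt0 n0.
    have d1 := divn_eq_dist M0 vl; have d2 := divn_eq_dist M0 (esym vl).
    have {}d1 : v%:R + 1 <= v0%:R + (n ^ l)%:R :> R by rewrite natr1 -natrD ler_nat.
    have {}d2 : v0%:R + 1 <= v%:R + (n ^ l)%:R :> R by rewrite natr1 -natrD ler_nat.
    by apply/andP; split; lra.
  (* Three powers of [k] are lost: the window has length below $2n^{l+1}\le n^{l+2}$, while the
     block is only guaranteed $k^{l-1}$ codes of the class. *)
  have k3l : (k ^ l.+2 <= k ^ 3 * k ^ l.-1)%N.
    by rewrite -expnD leq_pexp2l ?(ltnW k1)//; case: (l).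
  rewrite ler_pdivrMl ?ltr0n ?(leq_trans _ k3)//.
  apply: (@le_trans _ _ (k ^ l.+2)%:R); last first.
    by rewrite -natrM ler_nat (leq_trans k3l)// leq_mul2l cge orbT.
  rewrite -(powR_dim R l.+2 k1 n1); apply: ge0_ler_powR => //; rewrite ?nnegrE ?ler0n//.
    exact: le_trans La2.
  rewrite -/La; apply: (@le_trans _ _ (2 * (n ^ l.+1)%:R)); first lra.
  by rewrite (expnS n l.+1) natrM ler_pM2r ?ltr0n ?expn_gt0 ?n0// ler_nat.
(* Upper bound. A window shorter than $n^{l+1}$ meets at most two blocks of that length; the
   last-digit condition is dropped, and $2k^{l+1}\le k^3k^l$. *)
- have [l /andP[l1 l2]] : exists l : nat, (n ^ l)%:R <= La < (n ^ l.+1)%:R.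
    by apply: trunc_log_real => //; lra.
  have M0 : (0 < n ^ l.+1)%N by rewrite expn_gt0 n0.
  pose a := Num.truncn (y - La / 2).
  have cle : (count P (codes n ds i.+1) <= 2 * k ^ l.+1)%N.
    apply: (@leq_trans (count (predU (fun v => v %/ n ^ l.+1 == a %/ n ^ l.+1)%N
        (fun v => v %/ n ^ l.+1 == (a %/ n ^ l.+1).+1)%N) (codes n ds i.+1))).
      apply: sub_count => v; rewrite PE => /and3P[v1 v2 _] /=.
      apply: divn_window => //; apply/andP; split.
        by rewrite leqNgt /a truncn_gt_nat -ltNge (le_lt_trans v1)// ltr_nat.
      have ay : y - La / 2 < a%:R + 1 by rewrite natr1; exact: truncnS_gt.
      rewrite -(ltr_nat R) natrD; move: ay v2 l2.
      by move: (v%:R) (a%:R) ((n ^ l.+1)%:R) => v' a' n'; lra.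
    apply: (leq_trans (leq_addr (count (predI
        (fun v => v %/ n ^ l.+1 == a %/ n ^ l.+1)%N
        (fun v => v %/ n ^ l.+1 == (a %/ n ^ l.+1).+1)%N) (codes n ds i.+1)) _)).
    by rewrite count_predUI mul2n -addnn -sds leq_add// count_codes_le.
  apply: (@le_trans _ _ (2 * k ^ l.+1)%:R); first by rewrite ler_nat.
  apply: (@le_trans _ _ ((k ^ 3)%:R * (k ^ l)%:R)).
    rewrite -natrM ler_nat expnS mulnA leq_mul2r; apply/orP; right.
    by rewrite (@leq_trans (k * k))// ?leq_mul2r ?k1 ?orbT// mulnn leq_pexp2l// ltnW.
  rewrite ler_pM2l ?ltr0n ?(leq_trans _ k3)// -(powR_dim R l k1 n1).
  apply: ge0_ler_powR => //; rewrite ?nnegrE ?ler0n//.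
  exact: le_trans La2.
Qed.

(** * The trapezoid multiplier *)

Section Trapezoid.
Variable R : realType.
Notation mu := (@lebesgue_measure R).

(** Continuous and piecewise affine, so its transform is explicit and decays quadratically, hence is
    integrable; a sharp cut-off would only give decay of order one. *)
Definition trapezoid (t : R) : R := Num.min 1 (Num.max 0 ((4 - `|t|) / 2)).

Lemma trapezoid_ge0 t : 0 <= trapezoid t.
Proof. by rewrite le_min ler01 le_max lexx. Qed.

Lemma trapezoid_le1 t : trapezoid t <= 1.
Proof. by rewrite ge_min lexx. Qed.

Lemma trapezoid1 t : `|t| <= 2 -> trapezoid t = 1.
Proof.
move=> t2; apply/min_idPl; rewrite le_max; apply/orP; right.
by rewrite ler_pdivlMr// mul1r; lra.
Qed.

Lemma trapezoid0 t : 4 <= `|t| -> trapezoid t = 0.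
Proof.
move=> t4; rewrite /trapezoid (max_idPl _); first by apply/min_idPr.
by rewrite ler_pdivrMr// mul0r; lra.
Qed.

Lemma trapezoid_slope t : 2 <= `|t| <= 4 -> trapezoid t = (4 - `|t|) / 2.
Proof.
move=> /andP[t2 t4]; rewrite /trapezoid (max_idPr _).
  by apply/min_idPr; rewrite ler_pdivrMr// mul1r; lra.
by rewrite divr_ge0//; lra.
Qed.

Lemma continuous_trapezoid : continuous trapezoid.
Proof.
move=> t; rewrite /trapezoid.
apply: (@continuous_min R _ (cst 1) (fun t => Num.max 0 ((4 - `|t|) / 2)) t).
  exact: cvg_cst.
apply: (@continuous_max R _ (cst 0) (fun t => (4 - `|t|) / 2) t).
  exact: cvg_cst.
apply: cvgM; last exact: cvg_cst.
by apply: cvgB; [exact: cvg_cst|exact: norm_continuous].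
Qed.

Lemma is_derive_affine (w z x : R) : is_derive x 1 (fun t => w * t + z) w.
Proof.
apply: (is_derive_eq (is_deriveD (is_deriveM (is_derive_cst w x 1) (is_derive_id x 1))
  (is_derive_cst z x 1))).
by rewrite /= /GRing.scale/= mulr0 !addr0 mulr1.
Qed.

Lemma is_derive_sin_affine (b phi x : R) :
  is_derive x 1 (fun t => sin (b * t + phi)) (cos (b * x + phi) * b).
Proof. exact: is_derive1_comp (is_derive_affine b phi x). Qed.

Lemma is_derive_cos_affine (b phi x : R) :
  is_derive x 1 (fun t => cos (b * t + phi)) (- sin (b * x + phi) * b).
Proof. exact: is_derive1_comp (is_derive_affine b phi x). Qed.

Lemma is_derive1_continuous (f df : R -> R) :
  (forall x : R, is_derive x 1 f (df x)) -> continuous f.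
Proof.
move=> dfE x; apply: differentiable_continuous; apply/derivable1_diffP.
exact: (@ex_derive _ _ _ _ _ _ _ (dfE x)).
Qed.

Lemma continuous_cos_affine (b phi : R) : continuous (fun t => cos (b * t + phi)).
Proof. exact: is_derive1_continuous (is_derive_cos_affine b phi). Qed.

Lemma integral_affine_cos (u v b phi a c : R) : a < c -> b != 0 ->
  \int[mu]_(t in `[a, c]) ((u + v * t) * cos (b * t + phi)) =
  ((u + v * c) * sin (b * c + phi) / b + v * cos (b * c + phi) / b ^+ 2) -
  ((u + v * a) * sin (b * a + phi) / b + v * cos (b * a + phi) / b ^+ 2).
Proof.
move=> ac b0.
(* Antiderivative obtained by one integration by parts. *)
pose G t := (u + v * t) * sin (b * t + phi) / b + v * cos (b * t + phi) / b ^+ 2.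
have dG (x : R) : is_derive x 1 G ((u + v * x) * cos (b * x + phi)).
  have dl : is_derive x 1 (fun t => u + v * t) v.
    have -> : (fun t => u + v * t) = (fun t => v * t + u).
      by apply/funext => t; rewrite addrC.
    exact: is_derive_affine.
  apply: (is_derive_eq (is_deriveD
    (is_deriveM (is_deriveM dl (is_derive_sin_affine b phi x)) (is_derive_cst b^-1 x 1))
    (is_deriveM (is_deriveM (is_derive_cst v x 1) (is_derive_cos_affine b phi x))
      (is_derive_cst (b ^+ 2)^-1 x 1)))).
  rewrite /= /GRing.scale/= /cst; field.
  by [].
have cG : continuous G by exact: is_derive1_continuous dG.
rewrite /Rintegral (@continuous_FTC2 _ _ G)//.
- apply: continuous_in_subspaceT => x _; apply: cvgM.
    by apply: cvgD; [exact: cvg_cst|apply: cvgM; [exact: cvg_cst|exact: cvg_id]].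
  exact: continuous_cos_affine.
- split.
  + by move=> x _; exact: (@ex_derive _ _ _ _ _ _ _ (dG x)).
  + by apply: cvg_at_right_filter; exact: cG.
  + by apply: cvg_at_left_filter; exact: cG.
- by move=> x _; rewrite derive1E; exact: (@derive_val _ _ _ _ _ _ _ (dG x)).
Qed.

(** Turns integrals over the line into integrals over a compact interval. *)
Lemma trapezoidM_patch (g : R -> R) :
  (fun t => trapezoid t * g t) = (fun t => trapezoid t * g t) \_ `[-4, 4].
Proof.
apply/funext => t; rewrite patchE; case: ifPn => //.
rewrite notin_setE/= in_itv/= => /negP; rewrite -ler_norml -ltNge => t4.
by rewrite trapezoid0 ?mul0r// ltW.
Qed.

Lemma integrable_trapezoidM (g : R -> R) : continuous g ->
  mu.-integrable setT (EFin \o (fun t => trapezoid t * g t)).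
Proof.
move=> cg.
have cTg : continuous (fun t => trapezoid t * g t).
  by move=> t; apply: cvgM; [exact: continuous_trapezoid|exact: cg].
rewrite trapezoidM_patch -restrict_EFin.
have := @integrable_mkcond _ _ _ mu `[-4, 4] (EFin \o (fun t => trapezoid t * g t)) (measurable_itv _).
move=> /iffLR; apply.
apply: continuous_compact_integrable; first exact: segment_compact.
by apply: continuous_in_subspaceT => x _; exact: cTg.
Qed.

Lemma Rintegral_trapezoidM (g : R -> R) : continuous g ->
  \int[mu]_t (trapezoid t * g t) =
  \int[mu]_(t in `[-4, -2]) ((4 + t) / 2 * g t) + \int[mu]_(t in `[-2, 2]) g t
  + \int[mu]_(t in `[2, 4]) ((4 - t) / 2 * g t).
Proof.
move=> cg.
have cTg : continuous (fun t => trapezoid t * g t).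
  by move=> t; apply: cvgM; [exact: continuous_trapezoid|exact: cg].
have iTg (A : set R) : measurable A -> mu.-integrable A (EFin \o (fun t => trapezoid t * g t)).
  by move=> mA; apply: integrableS (integrable_trapezoidM cg).
have -> : \int[mu]_t (trapezoid t * g t) = \int[mu]_(t in `[-4, 4]) (trapezoid t * g t).
  by rewrite [RHS]Rintegral_mkcond -trapezoidM_patch.
have := @Rintegral_itvB _ (fun t => trapezoid t * g t) (BLeft (-4)) (BRight 4) (-2).
move=> /(_ (iTg _ _)); rewrite !bnd_simp.
move=> /(_ ltac:(by []) ltac:(lra) ltac:(lra)) /eqP.
rewrite subr_eq addrC => /eqP ->.
have := @Rintegral_itvB _ (fun t => trapezoid t * g t) (BRight (-2)) (BRight 4) 2.
move=> /(_ (iTg _ _)); rewrite !bnd_simp.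
move=> /(_ ltac:(by []) ltac:(lra) ltac:(lra)) /eqP.
rewrite subr_eq addrC => /eqP ->.
rewrite !Rintegral_itv_obnd_cbnd; [|exact: iTg..].
have -> : \int[mu]_(t in `[2, 4]) (trapezoid t * g t) =
    \int[mu]_(t in `[2, 4]) ((4 - t) / 2 * g t).
  apply: eq_Rintegral => t; rewrite inE/= in_itv/= => /andP[t1 t2].
  by rewrite trapezoid_slope ger0_norm ?t1//; lra.
have -> : \int[mu]_(t in `[-2, 2]) (trapezoid t * g t) = \int[mu]_(t in `[-2, 2]) g t.
  apply: eq_Rintegral => t; rewrite inE/= in_itv/= => /andP[t1 t2].
  by rewrite trapezoid1 ?mul1r// ler_norml t1.
have -> : \int[mu]_(t in `[-4, -2]) (trapezoid t * g t) =
    \int[mu]_(t in `[-4, -2]) ((4 + t) / 2 * g t).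
  apply: eq_Rintegral => t; rewrite inE/= in_itv/= => /andP[t1 t2].
  by rewrite trapezoid_slope ler0_norm ?opprK//; lra.
by ring.
Qed.

(* The trivial bound is 8 and integrating by parts on each slope gives 2 / b^2. *)
Lemma norm_Rintegral_trapezoid_cos (b phi : R) :
  `|\int[mu]_t (trapezoid t * cos (b * t + phi))| <= 12 / (1 + b ^+ 2).
Proof.
have cg := @continuous_cos_affine b phi.
have bound8 : `|\int[mu]_t (trapezoid t * cos (b * t + phi))| <= 8.
  rewrite trapezoidM_patch -Rintegral_mkcond.
  have iT : mu.-integrable `[-4, 4] (EFin \o (fun t => trapezoid t * cos (b * t + phi))).
    exact: integrableS (integrable_trapezoidM cg).
  apply: (le_trans (le_normr_Rintegral _ iT)) => //.
  apply: (@le_trans _ _ (\int[mu]_(t in `[-4, 4]) 1)).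
    apply: le_Rintegral => //.
    - exact: integrable_norm.
    - apply: continuous_compact_integrable; first exact: segment_compact.
      by apply: continuous_in_subspaceT => x _; exact: cvg_cst.
    - move=> t _; rewrite normrM -[leRHS]mulr1 ler_pM//.
        by rewrite ger0_norm ?trapezoid_ge0 ?trapezoid_le1.
      by rewrite ler_norml cos_geN1 cos_le1.
  have m8 : mu (`[-4, 4]%classic : set R) = 8%:E.
    rewrite lebesgue_measure_itv/= lte_fin ifT; last lra.
    by rewrite -EFinB; congr EFin; lra.
  by rewrite Rintegral_cst// [X in fine X]m8/=; lra.
(* The bound 8 suffices up to $b^2=1/2$, since $12/(1+b^2)\ge 8$ there; the bound $2/b^2$ suffices
   as soon as $b^2\ge 1/5$. *)
have [b5|b5] := leP (b ^+ 2) (1/2).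
  apply: (le_trans bound8); rewrite ler_pdivlMr; nra.
have b0 : b != 0 by apply: contraTneq b5 => ->; rewrite expr0n/=; lra.
have b2 : `|\int[mu]_t (trapezoid t * cos (b * t + phi))| <= 2 / b ^+ 2.
  rewrite Rintegral_trapezoidM//.
  have -> : \int[mu]_(t in `[-4, -2]) ((4 + t) / 2 * cos (b * t + phi)) =
     \int[mu]_(t in `[-4, -2]) ((2 + 2^-1 * t) * cos (b * t + phi)).
    by apply: eq_Rintegral => t _; congr (_ * _); lra.
  have -> : \int[mu]_(t in `[2, 4]) ((4 - t) / 2 * cos (b * t + phi)) =
     \int[mu]_(t in `[2, 4]) ((2 + (- 2^-1) * t) * cos (b * t + phi)).
    by apply: eq_Rintegral => t _; congr (_ * _); lra.
  have -> : \int[mu]_(t in `[-2, 2]) cos (b * t + phi) =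
     \int[mu]_(t in `[-2, 2]) ((1 + 0 * t) * cos (b * t + phi)).
    by apply: eq_Rintegral => t _; rewrite mul0r addr0 mul1r.
  rewrite !integral_affine_cos//; [|lra..].
  (* The sine terms at the breakpoints cancel by continuity of the trapezoid. Four cosines over
     $2b^2$ remain, which gives $2/b^2$. *)
  rewrite [X in `|X|](_ : _ = (cos (b * -2 + phi) + cos (b * 2 + phi)
    - cos (b * -4 + phi) - cos (b * 4 + phi)) / (2 * b ^+ 2)); last by field.
  have cosb (x : R) : -1 <= cos x <= 1 by rewrite cos_geN1 cos_le1.
  rewrite normrM [`|_^-1|]ger0_norm; last by rewrite invr_ge0 pmulr_rge0// sqr_ge0.
  rewrite invfM mulrA.
  rewrite ler_pM2r ?invr_gt0 ?exprn_even_gt0//.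
  rewrite ler_pdivrMr// ler_norml.
  move: (cosb (b * -2 + phi)) (cosb (b * 2 + phi)) (cosb (b * -4 + phi)).
  by move: (cosb (b * 4 + phi)); lra.
apply: (le_trans b2); rewrite ler_pdivrMr; last lra.
by rewrite mulrAC ler_pdivlMr; lra.
Qed.

End Trapezoid.

(** * Schur's test and the Cauchy kernel *)

(* Unlike [ge0_le_integral], no measurability is assumed. *)
Lemma ge0_le_integralT d (T : measurableType d) (R : realType)
    (m : {measure set T -> \bar R}) (f g : T -> \bar R) :
  (forall x, 0 <= f x)%E -> (forall x, f x <= g x)%E ->
  (\int[m]_x f x <= \int[m]_x g x)%E.
Proof.
move=> f0 fg.
rewrite !ge0_integralTE//; last by move=> x; apply: le_trans (fg x).
apply: le_ereal_sup => _ [h hf <-]; exists h => // x.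
by apply: le_trans (fg x); exact: hf.
Qed.

(** Writing [k] as $k^{1/p}k^{1/q}$, Hoelder's inequality and the first marginal bound the $p$-th
    power of the inner integral by $A^{p-1}\int f^p k$. Tonelli and the second marginal supply the
    last factor [A]. *)
Lemma schur_test d (T : measurableType d) (R : realType)
    (m : {sigma_finite_measure set T -> \bar R}) (k : T * T -> R) (f : T -> R) (A p : R) :
  1 < p -> 0 <= A -> measurable_fun setT k -> (forall z, 0 <= k z) ->
  (forall x, \int[m]_y (k (x, y))%:E <= A%:E)%E ->
  (forall y, \int[m]_x (k (x, y))%:E <= A%:E)%E ->
  measurable_fun setT f -> (forall y, 0 <= f y) ->
  (\int[m]_x (\int[m]_y (f y * k (x, y))%:E) `^ p <=
   (A `^ p)%:E * \int[m]_y (f y `^ p)%:E)%E.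
Proof.
move=> p1 A0 mk k0 kA1 kA2 mf f0.
have p0 : 0 < p by exact: lt_trans p1.
pose q := p / (p - 1).
have q0 : 0 < q by rewrite divr_gt0// subr_gt0.
have pq : p^-1 + q^-1 = 1 by rewrite /q; field; rewrite subr_eq0 !gt_eqF.
have qp : q^-1 * p = p - 1 by rewrite /q invf_div divfK// gt_eqF.
have mkx x : measurable_fun setT (fun y => k (x, y)).
  exact: measurableT_comp (measurable_pair1 x).
have mky y : measurable_fun setT (fun x => k (x, y)).
  exact: measurableT_comp (measurable_pair2 y).
have mpow d' (T' : measurableType d') (g : T' -> R) r :
    measurable_fun setT g -> measurable_fun setT (fun y => g y `^ r).
  exact: (@measurableT_comp _ _ _ _ _ _ (@powR R ^~ r)).
have step x : ((\int[m]_y (f y * k (x, y))%:E) `^ p <=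
    (A `^ (p - 1))%:E * \int[m]_y (f y `^ p * k (x, y))%:E)%E.
  have := @hoelder _ _ _ m (fun y => f y * k (x, y) `^ p^-1) (fun y => k (x, y) `^ q^-1) p q.
  move=> /(_ _ _ p0 q0 pq); rewrite Lnorm1.
  have -> : (\int[m]_y `|(((fun y0 => f y0 * k (x, y0) `^ p^-1) \*
      (fun y0 => k (x, y0) `^ q^-1)) y)%:E| = \int[m]_y (f y * k (x, y))%:E)%E.
    apply: eq_integral => y _; rewrite /= ger0_norm ?mulr_ge0 ?powR_ge0//.
    by rewrite -mulrA -powRD pq ?oner_eq0// powRr1.
  move=> /(_ _ _)/wrap[].
    by apply: measurable_funM => //; exact: mpow.
    exact: mpow.
  set N1 := (X in (_ <= X * _)%E); set N2 := (X in (_ <= _ * X)%E) => H.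
  have /le_trans : ((\int[m]_y (f y * k (x, y))%:E) `^ p <= (N1 * N2) `^ p)%E.
    apply: gt0_ler_poweR (ltW p0) _ _ _ _ H; rewrite in_itv/= leey andbT.
      by apply: integral_ge0 => y _; rewrite lee_fin mulr_ge0.
    by rewrite mule_ge0 ?Lnorm_ge0.
  apply; clear H; rewrite /N1 /N2 poweRM ?Lnorm_ge0// poweR_Lnorm ?gt_eqF// muleC.
  apply: lee_pmul; rewrite ?poweR_ge0//.
  - by apply: integral_ge0 => y _; rewrite poweR_ge0.
  - rewrite unlock -poweRrM qp -poweR_EFin.
    have -> : (\int[m]_y (`|(EFin \o (fun y0 => (k (x, y0) `^ q^-1)%R)) y| `^ q) =
        \int[m]_y (k (x, y))%:E)%E.
      apply: eq_integral => y _; rewrite /= ger0_norm ?powR_ge0//.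
      by rewrite -powRrM mulVf ?gt_eqF// powRr1.
    apply: gt0_ler_poweR (kA1 x); rewrite ?subr_ge0 ?(ltW p1)// in_itv/= leey andbT//.
    by apply: integral_ge0 => y _; rewrite lee_fin.
  - rewrite le_eqVlt; apply/orP; left; apply/eqP; apply: eq_integral => y _ /=.
    rewrite ger0_norm ?mulr_ge0 ?powR_ge0// powRM ?powR_ge0//.
    by rewrite -powRrM mulVf ?gt_eqF// powRr1.
apply: (@le_trans _ _ (\int[m]_x ((A `^ (p - 1))%:E * \int[m]_y (f y `^ p * k (x, y))%:E))%E).
  by apply: ge0_le_integralT => // x; exact: poweR_ge0.
have mfk : measurable_fun setT (fun z : T * T => (f z.2 `^ p * k z)%:E).
  apply/measurable_EFinP; apply: measurable_funM => //; apply: mpow.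
  exact: measurableT_comp measurable_snd.
have fk0 z : (0 <= (f z.2 `^ p * k z)%:E)%E by rewrite lee_fin mulr_ge0 ?powR_ge0.
rewrite ge0_integralZl_EFin ?powR_ge0//; last 2 first.
- by move=> x _; apply: integral_ge0 => y _; exact: (fk0 (x, y)).
- exact: (measurable_fun_fubini_tonelli_F (fun z : T * T => (f z.2 `^ p * k z)%:E)).
rewrite (fubini_tonelli (fun z : T * T => (f z.2 `^ p * k z)%:E))//=.
have -> : A `^ p = A `^ (p - 1) * A.
  by rewrite mulrC mulr_powRB1.
rewrite EFinM -muleA; apply: lee_wpmul2l; first by rewrite lee_fin powR_ge0.
rewrite -ge0_integralZl_EFin//; last 2 first.
- by move=> y _; rewrite lee_fin powR_ge0.
- by apply/measurable_EFinP; exact: mpow.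
apply: ge0_le_integralT => y; first by apply: integral_ge0 => x _; exact: (fk0 (x, y)).
under eq_integral do rewrite EFinM.
rewrite ge0_integralZl_EFin ?powR_ge0//; last 2 first.
- by move=> x _; rewrite lee_fin.
- exact/measurable_EFinP.
by rewrite muleC lee_wpmul2r// lee_fin powR_ge0.
Qed.

(** A convolution kernel, written on pairs of points to match [schur_test]; both of its marginals
    are [pi ^+ 2]. *)
Definition cauchy_kernel (R : realType) (z : (R * R) * (R * R)) : R :=
  (1 + (z.1.1 - z.2.1) ^+ 2)^-1 * (1 + (z.1.2 - z.2.2) ^+ 2)^-1.

Lemma integral_cauchy_half (R : realType) (y : R) :
  (\int[@lebesgue_measure R]_(x in `[y, +oo[) ((1 + (x - y) ^+ 2)^-1)%:E = (pi / 2)%:E)%E.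
Proof.
have dy (x : R) : is_derive x 1 (fun t => t - y) 1.
  apply: (is_derive_eq (is_deriveB (is_derive_id x 1) (is_derive_cst y x 1))).
  by rewrite subr0.
have dF (x : R) : is_derive x 1 (fun t => atan (t - y)) ((1 + (x - y) ^+ 2)^-1).
  apply: (is_derive_eq (@is_derive1_comp _ atan (fun t => t - y) x _ _ (is_derive1_atan _) (dy x))).
  by rewrite mulr1.
have cf : continuous (fun x => (1 + (x - y) ^+ 2)^-1 : R).
  move=> x; apply: (@continuous_comp _ _ _ (fun t => t - y) (fun t => (oneDsqr t)^-1)).
    by apply: cvgB; [exact: cvg_id|exact: cvg_cst].
  exact: continuous_oneDsqrV.
have cF (x : R) : {for x, continuous (fun t => atan (t - y))}.
  apply: differentiable_continuous; apply/derivable1_diffP.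
  exact: (@ex_derive _ _ _ _ _ _ _ (dF x)).
rewrite (@ge0_continuous_FTC2y _ _ (fun t => atan (t - y)) _ (pi / 2)).
- by rewrite subrr atan0 sube0.
- by move=> x _; rewrite invr_ge0 addr_ge0 ?sqr_ge0.
- by apply: continuous_in_subspaceT => x _; exact: cf.
- apply: (@cvg_comp _ _ _ (fun t => t - y) atan); last exact: cvgy_atan.
  exact: cvg_addrr.
- by move=> x _; exact: (@ex_derive _ _ _ _ _ _ _ (dF x)).
- by apply: cvg_at_right_filter; exact: cF.
- by move=> x _; rewrite derive1E; exact: (@derive_val _ _ _ _ _ _ _ (dF x)).
Qed.

(** Split at [y]; the reflection of the line turns the left half into another instance of the right
    half. *)
Lemma integral_cauchy (R : realType) (y : R) :
  (\int[@lebesgue_measure R]_x ((1 + (x - y) ^+ 2)^-1)%:E = pi%:E)%E.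
Proof.
have cf : continuous (fun x => (1 + (x - y) ^+ 2)^-1 : R).
  move=> x; apply: (@continuous_comp _ _ _ (fun t => t - y) (fun t => (oneDsqr t)^-1)).
    by apply: cvgB; [exact: cvg_id|exact: cvg_cst].
  exact: continuous_oneDsqrV.
have mf : measurable_fun setT (fun x : R => ((1 + (x - y) ^+ 2)^-1)%:E : \bar R).
  by apply/measurable_EFinP; exact: continuous_measurable_fun.
have f0 x : 0 <= (1 + (x - y) ^+ 2)^-1 :> R.
  by rewrite invr_ge0 addr_ge0 ?sqr_ge0.
have -> : setT = `]-oo, y] `|` `]y, +oo[ :> set R.
  apply/seteqP; split => // x _ /=; rewrite !in_itv/= andbT.
  by case: (leP x y) => xy; [left|right].
rewrite ge0_integral_setU//; last 3 first.
- exact: measurable_funTS.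
- by move=> x _; rewrite lee_fin.
- apply/disj_setPS => x [] /=; rewrite !in_itv/= andbT => xy /(le_lt_trans xy).
  by rewrite ltxx.
rewrite integral_itv_obnd_cbnd; last exact: measurable_funTS.
rewrite integral_cauchy_half -{1}[y]opprK ge0_integration_by_substitutionNy//; last first.
  by apply: continuous_in_subspaceT => x _; exact: cf.
have -> : (\int[lebesgue_measure]_(x in `[(- y)%R, +oo[)
   (((fun x0 => (1 + (x0 - y) ^+ 2)^-1) \o -%R) x)%:E =
   \int[lebesgue_measure]_(x in `[(- y)%R, +oo[) ((1 + (x - - y) ^+ 2)^-1)%:E :> \bar R)%E.
  by apply: eq_integral => x _ /=; congr (_ + _)^-1%:E; ring.
by rewrite integral_cauchy_half -EFinD; congr EFin; lra.
Qed.

(* The generic instance on products is hidden by the later one on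
   subprobabilities, hence a dedicated instance. *)
Lemma leb2_sigma_finite (R : realType) : sigma_finite setT (@leb2 R).
Proof.
exists (fun n => `[- n%:R, n%:R]%classic `*` `[- n%:R, n%:R]%classic).
  apply/seteqP; split => // -[x y] _.
  have [n [nx ny]] : exists n : nat, `|x| <= n%:R /\ `|y| <= n%:R.
    exists (Num.truncn (Num.max `|x| `|y|)).+1.
    have : Num.max `|x| `|y| <= (Num.truncn (Num.max `|x| `|y|)).+1%:R.
      by apply/ltW/truncnS_gt.
    by rewrite ge_max => /andP[].
  by exists n => //; split; rewrite /= in_itv/= -ler_norml.
move=> n; split; first exact: measurableX.
rewrite [ltLHS]product_measure1E//.
have mn : (lebesgue_measure (`[(- n%:R)%R, n%:R%R]%classic : set R) < +oo)%E.
  by rewrite lebesgue_measure_itv/=; case: ifP => // _; rewrite -EFinB ltry.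
by rewrite lte_mul_pinfty// ge0_fin_numE.
Qed.

HB.instance Definition _ (R : realType) := Measure.on (@leb2 R).
HB.instance Definition _ (R : realType) := Measure_isSigmaFinite.Build _ _ _ (@leb2 R) (@leb2_sigma_finite R).

(** * Integrals of products in separate variables *)

Section ProductFunctions.
Context d1 d2 (T1 : measurableType d1) (T2 : measurableType d2) (R : realType).
Variable m1 : {sigma_finite_measure set T1 -> \bar R}.
Variable m2 : {sigma_finite_measure set T2 -> \bar R}.
Variables (f : T1 -> R) (g : T2 -> R).
Hypothesis intf : m1.-integrable setT (EFin \o f).
Hypothesis intg : m2.-integrable setT (EFin \o g).

Lemma integrable_prod_meas : (m1 \x m2)%E.-integrable setT (fun z => (f z.1 * g z.2)%:E).
Proof.
have /measurable_EFinP mf := measurable_int _ intf.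
have /measurable_EFinP mg := measurable_int _ intg.
apply/integrable12ltyP.
  apply/measurable_EFinP; apply: measurable_funM.
    exact: measurableT_comp mf measurable_fst.
  exact: measurableT_comp mg measurable_snd.
under eq_integral => x _.
  under eq_integral => y _ do rewrite /= normrM EFinM.
  rewrite ge0_integralZl_EFin//; last by apply/measurable_EFinP; exact: measurableT_comp.
  over.
rewrite /= ge0_integralZr//; last 2 first.
- by apply/measurable_EFinP; exact: measurableT_comp.
- exact: integral_ge0.
move: intf intg => /integrableP[_ ify] /integrableP[_ igy].
by apply: lte_mul_pinfty => //; [exact: integral_ge0|rewrite ge0_fin_numE//; exact: integral_ge0].
Qed.

Lemma Rintegral_prod_meas :
  \int[(m1 \x m2)%E]_z (f z.1 * g z.2) = \int[m1]_x f x * \int[m2]_y g y.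
Proof.
rewrite /Rintegral -[X in fine X](integral12_prod_meas1 integrable_prod_meas).
rewrite /fubini_F/=.
have gfin := integrable_fin_num measurableT intg.
under eq_integral => x _.
  under eq_integral => y _ do rewrite EFinM.
  rewrite integralZl// -(fineK gfin); over.
by rewrite integralZr// fineM// integrable_fin_num.
Qed.

End ProductFunctions.

Lemma measurable_cos (R : realType) : measurable_fun setT (@cos R).
Proof. exact: continuous_measurable_fun (@continuous_cos R). Qed.

(** The addition formula for the cosine yields two products, each of two one-dimensional integrals
    bounded with the constant 12. *)
Definition multiplier_const (R : realType) : R := 2 * 12 ^+ 2.

Lemma multiplier_const_gt0 (R : realType) : 0 < multiplier_const R.
Proof. by rewrite mulr_gt0// exprn_gt0. Qed.

Lemma multiplier_const_ge0 (R : realType) : 0 <= multiplier_const R.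
Proof. exact: ltW (multiplier_const_gt0 R). Qed.

(** The phase splits into [b1 * z.1] and [b2 * z.2 + phi], and the addition formula separates the
    variables. Each sine is written as a cosine shifted by [pi / 2], so the one-dimensional bound
    covers all four factors. *)
Lemma norm_Rintegral_trapezoid2_cos (R : realType) (b1 b2 phi : R) :
  `|\int[@leb2 R]_z (trapezoid z.1 * trapezoid z.2 * cos (b1 * z.1 + b2 * z.2 + phi))| <=
  multiplier_const R / ((1 + b1 ^+ 2) * (1 + b2 ^+ 2)).
Proof.
pose c1 t : R := trapezoid t * cos (b1 * t + 0).
pose s1 t : R := trapezoid t * cos (b1 * t + - (pi / 2)).
pose c2 t : R := trapezoid t * cos (b2 * t + phi).
pose s2 t : R := trapezoid t * cos (b2 * t + (phi - pi / 2)).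
have i b f : (@lebesgue_measure R).-integrable setT (EFin \o (fun t => trapezoid t * cos (b * t + f))).
  by apply: integrable_trapezoidM; exact: continuous_cos_affine.
have -> : (fun z : R * R => trapezoid z.1 * trapezoid z.2 * cos (b1 * z.1 + b2 * z.2 + phi)) =
    (fun z => c1 z.1 * c2 z.2 - s1 z.1 * s2 z.2).
  apply/funext => z; rewrite /c1 /c2 /s1 /s2 addr0 addrA !cosBpihalf.
  by rewrite -(addrA (b1 * z.1)) cosD; ring.
rewrite RintegralB//; last 2 first.
- exact: (integrable_prod_meas (i b1 0) (i b2 phi)).
- exact: (integrable_prod_meas (i b1 (- (pi / 2))) (i b2 (phi - pi / 2))).
rewrite [X in `|X - _|](Rintegral_prod_meas (i b1 0) (i b2 phi)).
rewrite [X in `|_ - X|](Rintegral_prod_meas (i b1 (- (pi / 2))) (i b2 (phi - pi / 2))).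
apply: (le_trans (ler_normB _ _)); rewrite !normrM.
rewrite /multiplier_const [leRHS](_ : _ = 12 / (1 + b1 ^+ 2) * (12 / (1 + b2 ^+ 2)) +
  12 / (1 + b1 ^+ 2) * (12 / (1 + b2 ^+ 2))); last first.
  by field; rewrite !gt_eqF// ltr_pwDl// sqr_ge0.
by apply: lerD; apply: ler_pM => //; exact: norm_Rintegral_trapezoid_cos.
Qed.

Lemma measurable_sin (R : realType) : measurable_fun setT (@sin R).
Proof. exact: continuous_measurable_fun (@continuous_sin R). Qed.

Lemma integrableM_le1 d (T : measurableType d) (R : realType)
    (m : {measure set T -> \bar R}) (f g : T -> R) :
  m.-integrable setT (EFin \o f) -> measurable_fun setT g -> (forall x, `|g x| <= 1) ->
  m.-integrable setT (EFin \o (fun x => f x * g x)).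
Proof.
move=> intf mg g1; have /measurable_EFinP mf := measurable_int _ intf.
apply: le_integrable intf => //.
  by apply/measurable_EFinP; exact: measurable_funM.
by move=> x _; rewrite /= lee_fin normrM -[leRHS]mulr1 ler_wpM2l.
Qed.

(** * Fourier integrals and the trapezoid multiplier *)

Section RotatedIntegrals.
Context d (T : measurableType d) (R : realType) (m : {measure set T -> \bar R}).
Variables (f ph : T -> R) (ps : R).
Hypotheses (intf : m.-integrable setT (EFin \o f)) (mph : measurable_fun setT ph).

Lemma integrableM_cos : m.-integrable setT (EFin \o (fun y => f y * cos (ph y))).
Proof.
apply: integrableM_le1 => //; first exact: measurableT_comp (@measurable_cos R) mph.
by move=> x; rewrite ler_norml cos_geN1 cos_le1.
Qed.

Lemma integrableM_sin : m.-integrable setT (EFin \o (fun y => f y * sin (ph y))).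
Proof.
apply: integrableM_le1 => //; first exact: measurableT_comp (@measurable_sin R) mph.
by move=> x; rewrite ler_norml sin_geN1 sin_le1.
Qed.

Lemma RintegralM_cosD : \int[m]_y (f y * cos (ph y + ps)) =
  cos ps * \int[m]_y (f y * cos (ph y)) - sin ps * \int[m]_y (f y * sin (ph y)).
Proof.
rewrite -!RintegralZl//; [|exact: integrableM_sin|exact: integrableM_cos].
rewrite -RintegralB//; last 2 first.
- exact: (integrableZl _ (cos ps) integrableM_cos).
- exact: (integrableZl _ (sin ps) integrableM_sin).
by apply: eq_Rintegral => y _; rewrite cosD; ring.
Qed.

Lemma RintegralM_sinD : \int[m]_y (f y * sin (ph y + ps)) =
  cos ps * \int[m]_y (f y * sin (ph y)) + sin ps * \int[m]_y (f y * cos (ph y)).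
Proof.
rewrite -!RintegralZl//; [|exact: integrableM_cos|exact: integrableM_sin].
rewrite -RintegralD//; last 2 first.
- exact: (integrableZl _ (cos ps) integrableM_sin).
- exact: (integrableZl _ (sin ps) integrableM_cos).
by apply: eq_Rintegral => y _; rewrite sinD; ring.
Qed.

End RotatedIntegrals.

Lemma measurable_phase (R : realType) (a b c : R) :
  measurable_fun setT (fun z : measurableTypeR R * measurableTypeR R => a * z.1 + b * z.2 + c).
Proof.
by apply: measurable_funD => //; apply: measurable_funD; apply: measurable_funM.
Qed.

(* The inverse-transform integrand at [xi] as integrals against cosines of the
   phase [x - y], a sine being a cosine shifted by [pi / 2]. *)
Lemma ft_rotate (R : realType) (F : R * R -> R * R) (x xi : R * R) : cintegrable F ->
  let th := fun y : R * R => 2 * pi * (x.1 - y.1) * xi.1 + 2 * pi * (x.2 - y.2) * xi.2 in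
  let ps := 1 * (2 * pi * (xi.1 * x.1 + xi.2 * x.2)) in
  (ft F xi).1 * cos ps - (ft F xi).2 * sin ps =
    \int[@leb2 R]_y ((F y).1 * cos (th y + 0)) + \int[@leb2 R]_y ((F y).2 * cos (th y + pi / 2)) /\
  (ft F xi).1 * sin ps + (ft F xi).2 * cos ps =
    \int[@leb2 R]_y ((F y).1 * cos (th y + - (pi / 2))) + \int[@leb2 R]_y ((F y).2 * cos (th y + 0)).
Proof.
move=> [iF1 iF2] th ps.
pose ph (y : R * R) : R := -1 * (2 * pi * (y.1 * xi.1 + y.2 * xi.2)).
have mph : measurable_fun setT (ph : measurableTypeR R * measurableTypeR R -> R).
  have -> : ph = fun y => (- (2 * pi * xi.1)) * y.1 + (- (2 * pi * xi.2)) * y.2 + 0.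
    by apply/funext => y; rewrite /ph; ring.
  exact: measurable_phase.
(* The phase is the sum of those of the forward and the inverse transform, so rotating [ft F xi] by
   [ps] gives again an integral against [F]. *)
have thE y : th y = ph y + ps by rewrite /th /ph /ps; ring.
have c0 (f : R * R -> R) : \int[@leb2 R]_y (f y * cos (th y + 0)) =
    \int[@leb2 R]_y (f y * cos (ph y + ps)).
  by apply: eq_Rintegral => y _; rewrite addr0 thE.
have cm (f : R * R -> R) : \int[@leb2 R]_y (f y * cos (th y + - (pi / 2))) =
    \int[@leb2 R]_y (f y * sin (ph y + ps)).
  by apply: eq_Rintegral => y _; rewrite cosBpihalf thE.
have cp (f : R * R -> R) : (@leb2 R).-integrable setT (EFin \o f) ->
    \int[@leb2 R]_y (f y * cos (th y + pi / 2)) =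
    - \int[@leb2 R]_y (f y * sin (ph y + ps)).
  move=> intf; rewrite -mulN1r -RintegralZl//; last first.
    apply: integrableM_sin => //; apply: measurable_funD => //.
  by apply: eq_Rintegral => y _; rewrite cosDpihalf thE; ring.
rewrite !c0 cm cp// !(RintegralM_cosD ps _ mph)// !(RintegralM_sinD ps _ mph)//.
rewrite /ft /fourier/= -/ph.
rewrite RintegralB//; [|exact: integrableM_cos|exact: integrableM_sin].
rewrite RintegralD//; [|exact: integrableM_sin|exact: integrableM_cos].
by split; ring.
Qed.

Lemma cauchy_kernel_ge0 (R : realType) z : 0 <= @cauchy_kernel R z.
Proof. by rewrite mulr_ge0// invr_ge0 addr_ge0// sqr_ge0. Qed.

Lemma measurable_oneDsqrV (R : realType) : measurable_fun setT (fun t : R => (1 + t ^+ 2)^-1).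
Proof. exact: continuous_measurable_fun (@continuous_oneDsqrV R). Qed.

Lemma measurable_cauchy_kernel (R : realType) :
  measurable_fun setT (@cauchy_kernel R :
    ((measurableTypeR R * measurableTypeR R) * (measurableTypeR R * measurableTypeR R))%type -> R).
Proof.
apply: measurable_funM.
- apply: (measurableT_comp (@measurable_oneDsqrV R)); apply: measurable_funB.
    exact: measurableT_comp measurable_fst measurable_fst.
  exact: measurableT_comp measurable_fst measurable_snd.
- apply: (measurableT_comp (@measurable_oneDsqrV R)); apply: measurable_funB.
    exact: measurableT_comp measurable_snd measurable_fst.
  exact: measurableT_comp measurable_snd measurable_snd.
Qed.

Lemma cauchy_kernelC (R : realType) (x y : R * R) :
  cauchy_kernel (x, y) = cauchy_kernel (y, x).
Proof. by rewrite /cauchy_kernel/= -(sqrrN (x.1 - _)) -(sqrrN (x.2 - _)) !opprB. Qed.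

Lemma integral_cauchy_kernel (R : realType) (y : R * R) :
  (\int[@leb2 R]_x (cauchy_kernel (x, y))%:E = (pi ^+ 2)%:E)%E.
Proof.
pose g (t : R) : R := (1 + t ^+ 2)^-1.
have g0 t : 0 <= g t by rewrite invr_ge0 addr_ge0// sqr_ge0.
have mg (u : R) : measurable_fun setT (fun t : R => (g (t - u))%:E).
  apply/measurable_EFinP; apply: (measurableT_comp (@measurable_oneDsqrV R)).
  exact: measurable_funB.
have mG : measurable_fun setT
    (fun x : measurableTypeR R * measurableTypeR R => (cauchy_kernel (x, y))%:E).
  apply/measurable_EFinP; exact: measurableT_comp (@measurable_cauchy_kernel R) (measurable_pair2 y).
rewrite [LHS]fubini_tonelli1//; last by move=> x; rewrite lee_fin cauchy_kernel_ge0.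
rewrite /fubini_F /cauchy_kernel/=.
under eq_integral => t _.
  under eq_integral => u _ do rewrite EFinM.
  rewrite ge0_integralZl_EFin//; [|by move=> u _; rewrite lee_fin; exact: g0|exact: mg|exact: g0].
  rewrite integral_cauchy; over.
rewrite ge0_integralZr//; [|exact: mg|by move=> u _; rewrite lee_fin; exact: g0|by rewrite lee_fin pi_ge0].
by rewrite integral_cauchy -EFinM expr2.
Qed.

(** The double integrand is dominated by the trapezoids in [xi] times [f] in [y], both integrable,
    so Fubini applies. Integrating in [xi] first leaves the trapezoid transform at frequency
    $2\pi(x-y)$, whose decay gives the Cauchy kernel. *)
Lemma trapezoid2_multiplier (R : realType) (f : R * R -> R) (x : R * R) (phi : R) :
  (@leb2 R).-integrable setT (EFin \o f) ->
  let th := fun y xi : R * R =>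
    2 * pi * (x.1 - y.1) * xi.1 + 2 * pi * (x.2 - y.2) * xi.2 + phi in
  let g := fun xi : R * R =>
    trapezoid xi.1 * trapezoid xi.2 * \int[@leb2 R]_y (f y * cos (th y xi)) in
  (@leb2 R).-integrable setT (EFin \o g) /\
  (`|\int[@leb2 R]_xi g xi|%:E <=
    \int[@leb2 R]_y (`|f y| * (multiplier_const R * cauchy_kernel (x, y)))%:E)%E.
Proof.
move=> intf th g.
pose RR : measurableType _ := (measurableTypeR R * measurableTypeR R)%type.
pose T2 (xi : R * R) : R := trapezoid xi.1 * trapezoid xi.2.
have iT : (@leb2 R).-integrable setT (EFin \o T2).
  have iT1 : (@lebesgue_measure R).-integrable setT (EFin \o @trapezoid R).
    have -> : @trapezoid R = fun t => trapezoid t * cst 1 t by apply/funext => t; rewrite mulr1.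
    by apply: integrable_trapezoidM; exact: cst_continuous.
  exact: (integrable_prod_meas iT1 iT1).
pose H (z : RR * RR) : R := T2 z.1 * f z.2 * cos (th z.2 z.1).
have iH : (@leb2 R \x @leb2 R)%E.-integrable setT (EFin \o H).
  apply: integrableM_cos; first exact: (integrable_prod_meas iT intf).
  rewrite /th; apply: measurable_funD => //.
  apply: measurable_funD; apply: measurable_funM.
  - apply: measurable_funM => //; apply: measurable_funB => //.
    exact: measurableT_comp measurable_fst measurable_snd.
  - exact: measurableT_comp measurable_fst measurable_fst.
  - apply: measurable_funM => //; apply: measurable_funB => //.
    exact: measurableT_comp measurable_snd measurable_snd.
  - exact: measurableT_comp measurable_snd measurable_fst.
have mth1 xi : measurable_fun setT (fun y : RR => th y xi).
  have -> : (fun y : RR => th y xi) = fun y => (- (2 * pi * xi.1)) * y.1 +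
      (- (2 * pi * xi.2)) * y.2 + (2 * pi * (x.1 * xi.1 + x.2 * xi.2) + phi).
    by apply/funext => y; rewrite /th; ring.
  exact: measurable_phase.
have mth2 y : measurable_fun setT (fun xi : RR => th y xi) by exact: measurable_phase.
have gE xi : (g xi)%:E = (\int[@leb2 R]_y (H (xi, y))%:E)%E.
  rewrite /g -RintegralZl//; last exact: integrableM_cos.
  rewrite /Rintegral fineK; last first.
    apply: integrable_fin_num => //.
    exact: (integrableZl _ (T2 xi) (integrableM_cos intf (mth1 xi))).
  by apply: eq_integral => y _; rewrite /H /T2 mulrA.
have HE y : (\int[@leb2 R]_xi (H (xi, y))%:E)%E =
   (f y * \int[@leb2 R]_xi (T2 xi * cos (th y xi)))%:E.
  rewrite -RintegralZl//; last exact: integrableM_cos.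
  rewrite /Rintegral fineK; last first.
    apply: integrable_fin_num => //.
    exact: (integrableZl _ (f y) (integrableM_cos iT (mth2 y))).
  by apply: eq_integral => xi _; rewrite /H; congr EFin; ring.
have ig : (@leb2 R).-integrable setT (EFin \o g).
  have -> : EFin \o g = fubini_F (@leb2 R) (EFin \o H).
    by apply/funext => xi; rewrite /= gE.
  exact: (integrable_fubini_F iH).
split=> //.
rewrite EFin_normr_Rintegral//.
have -> : (\int[@leb2 R]_xi (g xi)%:E = \int[@leb2 R]_y \int[@leb2 R]_xi (H (xi, y))%:E)%E.
  rewrite -(Fubini iH); apply: eq_integral => xi _; exact: gE.
apply: (le_trans (le_abse_integral _ _ _)) => //.
  exact: (measurable_fubini_G iH).
apply: ge0_le_integralT => // y; rewrite HE /= lee_fin normrM.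
apply: ler_wpM2l => //.
apply: (le_trans (norm_Rintegral_trapezoid2_cos _ _ _)).
rewrite ler_pM2l ?multiplier_const_gt0// /cauchy_kernel/= -invfM.
(* Since $2\pi\ge1$, the frequency $2\pi(x-y)$ gives at least the decay expressed in $x-y$. *)
have pi21 : 1 <= (2 * pi : R) ^+ 2.
  by rewrite exprn_ege1// -[leLHS]mulr1 ler_pM// ?ler1n// (le_trans _ (pi_ge2 R))// ler1n.
have pos (t : R) : 0 < 1 + t ^+ 2 by rewrite ltr_pwDl// sqr_ge0.
rewrite lef_pV2 ?posrE ?mulr_gt0//.
apply: ler_pM; rewrite ?addr_ge0 ?sqr_ge0// lerD2l exprMn ler_peMl ?sqr_ge0//.
Qed.

(** * The $L^p$ bound for a transform followed by its inverse *)

Lemma cnorm_ge0 (R : realType) (z : R * R) : 0 <= cnorm z.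
Proof. exact: sqrtr_ge0. Qed.

Lemma norm1_le_cnorm (R : realType) (z : R * R) : `|z.1| <= cnorm z.
Proof. by rewrite -sqrtr_sqr ler_wsqrtr// lerDl sqr_ge0. Qed.

Lemma norm2_le_cnorm (R : realType) (z : R * R) : `|z.2| <= cnorm z.
Proof. by rewrite -sqrtr_sqr ler_wsqrtr// lerDr sqr_ge0. Qed.

Lemma cnorm_le_norm (R : realType) (z : R * R) : cnorm z <= `|z.1| + `|z.2|.
Proof.
rewrite -[leRHS]ger0_norm ?addr_ge0// -sqrtr_sqr ler_wsqrtr//.
rewrite sqrrD !real_normK ?num_real// lerD2r lerDl.
by rewrite mulrn_wge0// mulr_ge0.
Qed.

Lemma measurable_sqrt (R : realType) : measurable_fun setT (@Num.sqrt R).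
Proof. exact: continuous_measurable_fun (@sqrt_continuous R). Qed.

Lemma measurable_cnorm d (T : measurableType d) (R : realType) (F : T -> R * R) :
  measurable_fun setT (fun x => (F x).1) -> measurable_fun setT (fun x => (F x).2) ->
  measurable_fun setT (fun x => cnorm (F x)).
Proof.
move=> m1 m2; apply: (measurableT_comp (@measurable_sqrt R)) => //.
by apply: measurable_funD; exact: measurable_funX.
Qed.

Lemma measurable_cintegrable (R : realType) (F : R * R -> R * R) : cintegrable F ->
  measurable_fun setT (fun x : measurableTypeR R * measurableTypeR R => (F x).1) /\
  measurable_fun setT (fun x : measurableTypeR R * measurableTypeR R => (F x).2).
Proof.
move=> [/measurable_int i1 /measurable_int i2].
by split; [apply/measurable_EFinP; exact: i1|apply/measurable_EFinP; exact: i2].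
Qed.

(** The support condition allows the trapezoids to be inserted before the inverse transform. Real
    and imaginary part are then each a sum of two integrals treated by [trapezoid2_multiplier],
    whence the factor 4. *)
Lemma cnorm_ift_ft_le (R : realType) (F : R * R -> R * R) (x : R * R) :
  cintegrable F -> fsupp_in F [set xi | `|xi.1| <= 2 /\ `|xi.2| <= 2] ->
  ((cnorm (ift (ft F) x))%:E <=
   \int[@leb2 R]_y (cnorm (F y) * (4 * multiplier_const R * cauchy_kernel (x, y)))%:E)%E.
Proof.
move=> cF sF; have [iF1 iF2] := cF.
have [mF1 mF2] := measurable_cintegrable cF.
have mk : measurable_fun setT (fun y : measurableTypeR R * measurableTypeR R =>
    cauchy_kernel (x, y)).
  exact: measurableT_comp (@measurable_cauchy_kernel R) (measurable_pair1 x).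
(* Stated for any [e] vanishing at the origin, to serve both components of the inverse-transform
   integrand. *)
have ftT xi (e : R * R -> R) : e (0, 0) = 0 ->
    e (ft F xi) = trapezoid xi.1 * trapezoid xi.2 * e (ft F xi).
  move=> e0; have [[x1 x2]|xi2] := pselect (`|xi.1| <= 2 /\ `|xi.2| <= 2).
    by rewrite !trapezoid1// !mul1r.
  by rewrite sF// e0 mulr0.
have k0 y : 0 <= multiplier_const R * cauchy_kernel (x, y).
  by rewrite mulr_ge0 ?multiplier_const_ge0 ?cauchy_kernel_ge0.
pose I := (\int[@leb2 R]_y (cnorm (F y) * (multiplier_const R * cauchy_kernel (x, y)))%:E)%E.
have bnd (f : R * R -> R) phi : (@leb2 R).-integrable setT (EFin \o f) ->
    (forall y, `|f y| <= cnorm (F y)) ->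
  (`|\int[@leb2 R]_xi (trapezoid xi.1 * trapezoid xi.2 * \int[@leb2 R]_y (f y *
    cos (2 * pi * (x.1 - y.1) * xi.1 + 2 * pi * (x.2 - y.2) * xi.2 + phi)))|%:E <= I)%E.
  move=> intf fF; apply: (le_trans (trapezoid2_multiplier x phi intf).2).
  apply: ge0_le_integralT => y; rewrite lee_fin.
    by rewrite mulr_ge0 ?k0.
  by apply: ler_wpM2r (fF y); exact: k0.
have n1 := fun y => norm1_le_cnorm (F y).
have n2 := fun y => norm2_le_cnorm (F y).
have b1 : (`|(ift (ft F) x).1|%:E <= I + I)%E.
  rewrite /ift /fourier/=.
  under eq_Rintegral => xi _.
    rewrite (ftT xi (fun z => z.1 * cos (1 * (2 * pi * (xi.1 * x.1 + xi.2 * x.2))) -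
       z.2 * sin (1 * (2 * pi * (xi.1 * x.1 + xi.2 * x.2))))); last by rewrite /= !mul0r subr0.
    rewrite (ft_rotate x xi cF).1 mulrDr; over.
  rewrite RintegralD//; [|exact: (trapezoid2_multiplier x _ iF1).1|exact: (trapezoid2_multiplier x _ iF2).1].
  apply: (@le_trans _ _ (_ + _)%:E); first by rewrite lee_fin; exact: ler_normD.
  by rewrite EFinD leeD// bnd.
have b2 : (`|(ift (ft F) x).2|%:E <= I + I)%E.
  rewrite /ift /fourier/=.
  under eq_Rintegral => xi _.
    rewrite (ftT xi (fun z => z.1 * sin (1 * (2 * pi * (xi.1 * x.1 + xi.2 * x.2))) +
       z.2 * cos (1 * (2 * pi * (xi.1 * x.1 + xi.2 * x.2))))); last by rewrite /= !mul0r addr0.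
    rewrite (ft_rotate x xi cF).2 mulrDr; over.
  rewrite RintegralD//; [|exact: (trapezoid2_multiplier x _ iF1).1|exact: (trapezoid2_multiplier x _ iF2).1].
  apply: (@le_trans _ _ (_ + _)%:E); first by rewrite lee_fin; exact: ler_normD.
  by rewrite EFinD leeD// bnd.
apply: (@le_trans _ _ (I + I + (I + I))%E).
  apply: (@le_trans _ _ (_ + _)%:E); first by rewrite lee_fin; exact: cnorm_le_norm.
  by rewrite EFinD leeD.
have -> : (\int[@leb2 R]_y (cnorm (F y) * (4 * multiplier_const R * cauchy_kernel (x, y)))%:E = 4%:E * I)%E.
  rewrite /I -ge0_integralZl_EFin//; last 2 first.
  - by move=> y _; rewrite lee_fin mulr_ge0 ?cnorm_ge0 ?k0.
  - apply/measurable_EFinP; apply: measurable_funM; first exact: measurable_cnorm.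
    exact: measurable_funM.
  by apply: eq_integral => y _; rewrite -EFinM; congr EFin; ring.
rewrite (_ : 4 = 1 + 1 + (1 + 1)); last by ring.
rewrite !EFinD !ge0_muleDl ?mul1e// ?lee_fin//.
Qed.

(** Schur's test applied to the pointwise bound; the kernel is symmetric, so one marginal
    computation gives both. The constant depends neither on [F] nor on [p]. *)
Lemma pnorm_ift_ft_le (R : realType) (p : R) (F : R * R -> R * R) : 1 < p ->
  cintegrable F -> fsupp_in F [set xi | `|xi.1| <= 2 /\ `|xi.2| <= 2] ->
  (pnorm p (ift (ft F)) <= (4 * multiplier_const R * pi ^+ 2)%:E * pnorm p F)%E.
Proof.
move=> p1 cF sF; have [mF1 mF2] := measurable_cintegrable cF.
have p0 : 0 < p by exact: lt_trans p1.
pose k (z : (measurableTypeR R * measurableTypeR R) * (measurableTypeR R * measurableTypeR R)) : R :=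
  4 * multiplier_const R * cauchy_kernel z.
have mk : measurable_fun setT k.
  by apply: measurable_funM => //; exact: measurable_cauchy_kernel.
have c0 : 0 <= 4 * multiplier_const R by rewrite mulr_ge0 ?multiplier_const_ge0.
have k0 z : 0 <= k z by rewrite mulr_ge0 ?cauchy_kernel_ge0.
have kA y : (\int[@leb2 R]_x (k (x, y))%:E <= (4 * multiplier_const R * pi ^+ 2)%:E)%E.
  under eq_integral do rewrite EFinM.
  rewrite ge0_integralZl_EFin//; last 2 first.
  - by move=> z _; rewrite lee_fin cauchy_kernel_ge0.
  - apply/measurable_EFinP; exact: measurableT_comp (@measurable_cauchy_kernel R) (measurable_pair2 y).
  by rewrite integral_cauchy_kernel -EFinM.
have kA' x : (\int[@leb2 R]_y (k (x, y))%:E <= (4 * multiplier_const R * pi ^+ 2)%:E)%E.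
  apply: le_trans (kA x); rewrite le_eqVlt; apply/orP; left; apply/eqP.
  by apply: eq_integral => y _; rewrite /k cauchy_kernelC.
have A0 : 0 <= 4 * multiplier_const R * pi ^+ 2 by rewrite mulr_ge0 ?sqr_ge0.
have := schur_test p1 A0 mk k0 kA' kA (measurable_cnorm mF1 mF2) (fun y => cnorm_ge0 (F y)).
rewrite /pnorm unlock => H.
apply: (@le_trans _ _ (((((4 * multiplier_const R * pi ^+ 2) `^ p)%:E *
    \int[@leb2 R]_y (cnorm (F y) `^ p)%:E) `^ p^-1)%E)).
  apply: gt0_ler_poweR.
  - by rewrite invr_ge0 ltW.
  - by rewrite in_itv/= leey andbT; apply: integral_ge0 => y _; rewrite lee_fin powR_ge0.
  - rewrite in_itv/= leey andbT mule_ge0 ?lee_fin ?powR_ge0//.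
    by apply: integral_ge0 => y _; rewrite lee_fin powR_ge0.
  - apply: le_trans H; apply: ge0_le_integralT => x; first exact: poweR_ge0.
    apply: gt0_ler_poweR; rewrite ?(ltW p0) ?in_itv/= ?leey ?andbT//.
      by apply: integral_ge0 => y _; rewrite lee_fin mulr_ge0// cnorm_ge0.
    by rewrite ger0_norm ?cnorm_ge0//; exact: cnorm_ift_ft_le.
rewrite poweRM; last 2 first.
- by rewrite lee_fin powR_ge0.
- by apply: integral_ge0 => y _; rewrite lee_fin powR_ge0.
rewrite poweR_EFin -powRrM mulfV ?gt_eqF// powRr1// lee_wpmul2l ?lee_fin//.
rewrite le_eqVlt; apply/orP; left; apply/eqP; congr poweR.
by apply: eq_integral => y _; rewrite /= ger0_norm ?cnorm_ge0.
Qed.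

(** * Sums of complex-valued functions *)

Lemma cnormD (R : realType) (z w : R * R) : cnorm (z.1 + w.1, z.2 + w.2) <= cnorm z + cnorm w.
Proof.
have zz : cnorm z ^+ 2 = z.1 ^+ 2 + z.2 ^+ 2 by rewrite sqr_sqrtr// addr_ge0 ?sqr_ge0.
have ww : cnorm w ^+ 2 = w.1 ^+ 2 + w.2 ^+ 2 by rewrite sqr_sqrtr// addr_ge0 ?sqr_ge0.
have z0 := cnorm_ge0 z; have w0 := cnorm_ge0 w.
have cs : z.1 * w.1 + z.2 * w.2 <= cnorm z * cnorm w.
  apply: (le_trans (ler_norm _)); rewrite -ler_sqr ?nnegrE ?mulr_ge0//.
  rewrite real_normK ?num_real// exprMn zz ww -subr_ge0.
  (* Cauchy-Schwarz in the plane, by Lagrange's identity. *)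
  rewrite (_ : _ - _ = (z.1 * w.2 - z.2 * w.1) ^+ 2) ?sqr_ge0//; ring.
rewrite -[leRHS]ger0_norm ?addr_ge0// -sqrtr_sqr ler_wsqrtr//=.
by rewrite [leRHS]sqrrD zz ww; lra.
Qed.

Lemma pnorm_ge0 (R : realType) (p : R) F : (0 <= pnorm p F :> \bar R)%E.
Proof. exact: Lnorm_ge0. Qed.

(** The pointwise inequality [cnormD] reduces this to Minkowski's inequality for the real-valued
    moduli. *)
Lemma pnormD_le (R : realType) (p : R) (F G : R * R -> R * R) : 1 <= p ->
  cintegrable F -> cintegrable G ->
  (pnorm p (fun x => ((F x).1 + (G x).1, (F x).2 + (G x).2)%R) <= pnorm p F + pnorm p G)%E.
Proof.
move=> p1 /measurable_cintegrable[mF1 mF2] /measurable_cintegrable[mG1 mG2].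
have p0 : 0 < p by exact: lt_le_trans p1.
apply: le_trans (minkowski_EFin _ (measurable_cnorm mF1 mF2) (measurable_cnorm mG1 mG2) p1).
rewrite /pnorm unlock; apply: gt0_ler_poweR.
- by rewrite invr_ge0 ltW.
- by rewrite in_itv/= leey andbT; apply: integral_ge0 => y _; rewrite lee_fin powR_ge0.
- by rewrite in_itv/= leey andbT; apply: integral_ge0 => y _; rewrite lee_fin powR_ge0.
apply: ge0_le_integralT => x; first by rewrite lee_fin powR_ge0.
rewrite lee_fin; apply: ge0_ler_powR; rewrite ?nnegrE ?(ltW p0)//.
rewrite /= ger0_norm ?cnorm_ge0// ger0_norm ?addr_ge0 ?cnorm_ge0//; exact: cnormD.
Qed.

(** Taken over a list, so that integrability, transform and norm of a sum are handled by
    induction. *)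
Definition csum (R : realType) (I : Type) (r : seq I) (F : I -> R * R -> R * R) (x : R * R) : R * R :=
  ((\sum_(a <- r) (F a x).1)%R, (\sum_(a <- r) (F a x).2)%R).

Lemma csum_cons (R : realType) (I : Type) a (r : seq I) (F : I -> R * R -> R * R) :
  csum (a :: r) F = fun x => ((F a x).1 + (csum r F x).1, (F a x).2 + (csum r F x).2).
Proof. by apply/funext => x; rewrite /csum !big_cons. Qed.

Lemma cintegrableD (R : realType) (F G : R * R -> R * R) : cintegrable F -> cintegrable G ->
  cintegrable (fun x => ((F x).1 + (G x).1, (F x).2 + (G x).2)%R).
Proof.
move=> [F1 F2] [G1 G2]; split => /=.
  by have := integrableD measurableT F1 G1; apply: eq_integrable.
by have := integrableD measurableT F2 G2; apply: eq_integrable.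
Qed.

Lemma csum_nil (R : realType) (I : Type) (F : I -> R * R -> R * R) :
  csum [::] F = fun => (0, 0).
Proof. by apply/funext => x; rewrite /csum !big_nil. Qed.

Lemma cintegrable0 (R : realType) : cintegrable (fun=> (0, 0) : R * R).
Proof. by split; exact: integrable0. Qed.

Lemma cintegrable_csum (R : realType) (I : eqType) (r : seq I) (F : I -> R * R -> R * R) :
  {in r, forall a, cintegrable (F a)} -> cintegrable (csum r F).
Proof.
elim: r => [_|a r IH ir]; first by rewrite csum_nil; exact: cintegrable0.
rewrite csum_cons; apply: cintegrableD; first by apply: ir; rewrite mem_head.
by apply: IH => b br; apply: ir; rewrite in_cons br orbT.
Qed.

Lemma ftD (R : realType) (F G : R * R -> R * R) xi : cintegrable F -> cintegrable G ->
  ft (fun x => ((F x).1 + (G x).1, (F x).2 + (G x).2)%R) xi =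
  ((ft F xi).1 + (ft G xi).1, (ft F xi).2 + (ft G xi).2).
Proof.
move=> [F1 F2] [G1 G2]; rewrite /ft /fourier/=.
pose ph (y : R * R) : R := -1 * (2 * pi * (y.1 * xi.1 + y.2 * xi.2)).
have mph : measurable_fun setT (ph : measurableTypeR R * measurableTypeR R -> R).
  have -> : ph = fun y => (- (2 * pi * xi.1)) * y.1 + (- (2 * pi * xi.2)) * y.2 + 0.
    by apply/funext => y; rewrite /ph; ring.
  exact: measurable_phase.
have c (f : R * R -> R) := @integrableM_cos _ _ _ (@leb2 R) f ph ^~ mph.
have s (f : R * R -> R) := @integrableM_sin _ _ _ (@leb2 R) f ph ^~ mph.
congr (_, _).
  rewrite -RintegralD//; last 2 first.
  - exact: (integrableB measurableT (c _ F1) (s _ F2)).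
  - exact: (integrableB measurableT (c _ G1) (s _ G2)).
  by apply: eq_Rintegral => y _; ring.
rewrite -RintegralD//; last 2 first.
- exact: (integrableD measurableT (s _ F1) (c _ F2)).
- exact: (integrableD measurableT (s _ G1) (c _ G2)).
by apply: eq_Rintegral => y _; ring.
Qed.

Lemma ft0 (R : realType) xi : ft (fun=> (0, 0) : R * R) xi = (0, 0).
Proof.
rewrite /ft /fourier/=; congr (_, _).
  by under eq_Rintegral do rewrite !mul0r subr0; rewrite /Rintegral integral0.
by under eq_Rintegral do rewrite !mul0r addr0; rewrite /Rintegral integral0.
Qed.

Lemma ft_csum (R : realType) (I : eqType) (r : seq I) (F : I -> R * R -> R * R) xi :
  {in r, forall a, cintegrable (F a)} ->
  ft (csum r F) xi = csum r (fun a => ft (F a)) xi.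
Proof.
elim: r => [_|a r IH ir]; first by rewrite !csum_nil ft0.
have ir' : {in r, forall a, cintegrable (F a)}.
  by move=> b br; apply: ir; rewrite in_cons br orbT.
rewrite !csum_cons ftD ?IH//; first by apply: ir; rewrite mem_head.
exact: cintegrable_csum.
Qed.

Lemma pnorm_csum_le (R : realType) (p : R) (I : eqType) (r : seq I) (F : I -> R * R -> R * R) :
  1 <= p -> {in r, forall a, cintegrable (F a)} ->
  (pnorm p (csum r F) <= \sum_(a <- r) pnorm p (F a))%E.
Proof.
move=> p1; elim: r => [_|a r IH ir].
  rewrite csum_nil big_nil /pnorm.
  have -> : (fun x : R * R => (cnorm (0, 0) : R)%:E) = cst 0%E.
    by apply/funext => x; rewrite /cnorm/= expr0n/= addr0 sqrtr0.
  by rewrite Lnorm0// eqe gt_eqF// (lt_le_trans _ p1).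
have ir' : {in r, forall a, cintegrable (F a)}.
  by move=> b br; apply: ir; rewrite in_cons br orbT.
rewrite csum_cons big_cons; apply: (le_trans (pnormD_le p1 _ _)).
- by apply: ir; rewrite mem_head.
- exact: cintegrable_csum.
- by rewrite leeD// IH.
Qed.

(** * Decoupling *)

Section Classes.
Variables (R : realType) (n : nat) (D : {set 'I_n}) (j : nat).
Hypothesis n1 : (1 < n)%N.
Let n0 : (0 < n)%N. Proof. exact: ltnW. Qed.

Definition word_class (d : 'I_n) : {set {ffun 'I_j.+1 -> 'I_n}} :=
  [set a in digit_words D j.+1 | a ord_max == d].

Lemma word_classE d a :
  (a \in word_class d) = (a \in digit_words D j.+1) && (a ord_max == d).
Proof. by rewrite !inE. Qed.

Lemma perm_code_class d : perm_eq [seq code a | a <- enum (word_class d)]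
  [seq v <- codes n (digits D) j.+1 | (v %% n == d)%N].
Proof.
apply: uniq_perm.
- by rewrite map_inj_uniq ?enum_uniq//; exact: code_inj.
- by rewrite filter_uniq// uniq_codes//; [exact: digits_lt|exact: uniq_digits].
move=> v; rewrite mem_filter -(perm_mem (perm_codes D j.+1 n0)).
apply/mapP/andP => [[a]|[vd /mapP[a]]].
  rewrite mem_enum inE => /andP[aD /eqP ad] ->; split; first by rewrite code_mod ad.
  by apply/mapP; exists a => //; rewrite mem_enum.
rewrite mem_enum => aD va; exists a => //; rewrite mem_enum inE aD/=.
by rewrite -val_eqE/= -code_mod -va.
Qed.

(** Only the first [j] digits are free in a class. *)
Lemma card_word_class d : d \in D -> #|word_class d| = (#|D| ^ j)%N.
Proof.
move=> dD; rewrite cardE -(size_map (@code n j.+1)) (perm_size (perm_code_class d)) size_filter.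
have := @count_codesS n (digits D) (@digits_lt n D) n0 predT (fun e => e == d :> nat) j.
rewrite count_predT size_codes size_digits -/(count_mem (val d) _) count_uniq_mem ?uniq_digits//.
have -> : val d \in digits D by apply/mapP; exists d => //; rewrite mem_enum.
by rewrite muln1 => <-.
Qed.

Lemma AD_regular_word_class (k : nat) d : (1 < k)%N -> (k < n)%N -> #|D| = k ->
  AD_regular (ln (k%:R : R) / ln (n%:R : R)) (n%:R ^+ j.+1) (k ^ 3)%:R
    [seq cpt R a | a <- enum (word_class d)].
Proof.
move=> k1 kn Dk; rewrite -natrX.
have -> : [seq cpt R a | a <- enum (word_class d)] =
    [seq v%:R / (n ^ j.+1)%:R | v <- [seq code a | a <- enum (word_class d)]].
  by rewrite -map_comp; apply: eq_map => a /=; rewrite cpt_code// natrX.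
apply: (AD_regular_class R k1 kn _ _ _ (perm_code_class d)).
- by rewrite size_digits.
- exact: uniq_digits.
- exact: digits_lt.
Qed.

Lemma cpt_inj : injective (@cpt R n j.+1).
Proof.
move=> a b; rewrite !cpt_code// => /(congr1 (fun x => x * n%:R ^+ j.+1)).
rewrite !divfK ?expf_neq0 ?pnatr_eq0 -?lt0n// => /eqP; rewrite eqr_nat => /eqP.
exact: code_inj.
Qed.

Lemma cpt_bounds a : a \in digit_words D j.+1 ->
  0 <= cpt R a /\ cpt R a + (n%:R ^+ j.+1)^-1 <= 1.
Proof.
move=> aD; rewrite cpt_code//.
have N0 : (0 : R) < n%:R ^+ j.+1 by rewrite exprn_gt0// ltr0n.
split; first by rewrite divr_ge0// ltW.
rewrite -[X in _ + X]mul1r -mulrDl ler_pdivrMr// mul1r natr1 -natrX ler_nat.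
exact: (codes_lt (@digits_lt n D) (mem_codes aD)).
Qed.

(** Points of the region have first coordinate in $[0,1]$ and vertical offset at most 1. The square
    is the one on which both trapezoids equal 1. *)
Lemma theta_box a : a \in digit_words D j.+1 ->
  theta a `<=` [set xi : R * R | `|xi.1| <= 2 /\ `|xi.2| <= 2].
Proof.
move=> /cpt_bounds[c0 c1] _ [x [t [xI [tn ->]]]].
move: xI; rewrite /= in_itv/= => /andP[x0 x1].
have n2 : (n%:R ^+ (2 * j.+1))^-1 <= 1 :> R.
  by rewrite invf_le1 ?exprn_gt0 ?ltr0n// exprn_ege1// ler1n.
have xle : 0 <= x <= 1 by lra.
have t1 : `|t| <= 1 by exact: le_trans tn n2.
have x2 : 0 <= x ^+ 2 <= 1 by rewrite sqr_ge0 expr_le1//; lra.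
move: t1; rewrite !ler_norml => t1; split; lra.
Qed.

(** Neighbouring intervals of one level may share an endpoint, but inside a class the left endpoints
    are more than one interval length apart. A common point of two regions would have its first
    coordinate in both intervals. *)
Lemma theta_disjoint (k : nat) d a b xi : (1 < k)%N -> (k < n)%N -> #|D| = k ->
  a \in word_class d -> b \in word_class d -> a != b ->
  theta a xi -> ~ @theta R n j.+1 b xi.
Proof.
move=> k1 kn Dk aC bC ab [x [t [+ [_ ->]]]] [x' [t' [+ [_ [xx _]]]]].
rewrite -{}xx /= !in_itv/= => /andP[x1 x2] /andP[x3 x4].
have [_ _ sep _] := AD_regular_word_class d k1 kn Dk.
have := sep (cpt R a) (cpt R b) (map_f _ _) (map_f _ _).
rewrite !mem_enum => /(_ aC bC); rewrite (inj_eq cpt_inj) => /(_ ab).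
by apply/negP; rewrite -leNgt ler_norml; lra.
Qed.

(** On the region of [a] the transforms of all other members of the class vanish by disjointness,
    and off it the transform of [F a] vanishes. The indicator thus cuts out exactly [ft (F a)],
    including at boundary points. *)
Lemma Fpiece_csum (k : nat) d (F : {ffun 'I_j.+1 -> 'I_n} -> R * R -> R * R) a :
  (1 < k)%N -> (k < n)%N -> #|D| = k ->
  (forall b, b \in digit_words D j.+1 -> cintegrable (F b) /\ fsupp_in (F b) (theta b)) ->
  a \in word_class d ->
  Fpiece (csum (enum (word_class d)) F) (theta a) = ift (ft (F a)).
Proof.
move=> k1 kn Dk hF aC; rewrite /Fpiece; congr ift; apply/funext => xi.
have CD b : b \in word_class d -> b \in digit_words D j.+1.
  by rewrite inE => /andP[].
rewrite ft_csum; last by move=> b; rewrite mem_enum => /CD /hF[].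
rewrite indicE; case: (boolP (xi \in theta a)) => [/set_mem xa|].
  have z b : b \in word_class d -> b != a -> ft (F b) xi = (0, 0).
    move=> bC ba; apply: (hF _ (CD _ bC)).2.
    by apply: (theta_disjoint k1 kn Dk aC bC _ xa); rewrite eq_sym.
  rewrite /csum; cbn [fst snd]; rewrite !big_enum !mul1r [RHS]surjective_pairing; congr (_, _).
    by rewrite (bigD1 a)// big1 => [|b /andP[bC ba]]; [exact: addr0|rewrite z].
  by rewrite (bigD1 a)// big1 => [|b /andP[bC ba]]; [exact: addr0|rewrite z].
rewrite notin_setE => xa; rewrite !mul0r; apply/esym.
exact: (hF _ (CD _ aC)).2.
Qed.

End Classes.

Lemma poweR_sqrt_scale (R : realType) (I : finType) (P : pred I) (A : R) (u v : I -> \bar R) :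
  0 <= A -> (forall a, 0 <= u a)%E -> (forall a, 0 <= v a)%E ->
  (forall a, P a -> u a <= A%:E * v a)%E ->
  (poweR (\sum_(a | P a) (u a * u a)) 2^-1 <= A%:E * poweR (\sum_(a | P a) (v a * v a)) 2^-1)%E.
Proof.
move=> A0 u0 v0 uv.
have S0 : (0 <= \sum_(a | P a) v a * v a)%E by apply: sume_ge0 => a _; rewrite mule_ge0.
have -> : A%:E = poweR (A%:E * A%:E) 2^-1.
  by rewrite -EFinM poweR_EFin -expr2 -powR_mulrn// -powRrM mulfV// powRr1.
rewrite -poweRM ?mule_ge0 ?lee_fin//; apply: gt0_ler_poweR => //.
- by rewrite in_itv/= leey andbT; apply: sume_ge0 => a _; rewrite mule_ge0.
- by rewrite in_itv/= leey andbT !mule_ge0// lee_fin.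
rewrite ge0_sume_distrr; last by move=> a _; rewrite mule_ge0.
apply: lee_sum => a Pa; rewrite muleACA; apply: lee_pmul => //; exact: uv.
Qed.

(** The decoupling hypothesis appears with its constant [K] already chosen, so that one [K] serves
    every [j] and [d]. It is applied at scale $R=n^{2(j+1)}$, where its regions are those of level
    [j.+1]; the resulting pieces are controlled by [pnorm_ift_ft_le]. *)
Lemma class_decoupling (R : realType) (n k : nat) (p c eps K : R) (D : {set 'I_n}) (j : nat)
    (F : {ffun 'I_j.+1 -> 'I_n} -> R * R -> R * R) (d : 'I_n) :
  (1 < k)%N -> (k < n)%N -> 1 < p -> #|D| = k -> d \in D ->
  (forall (Rr : R) (s : seq R) (F : R * R -> R * R),
    1 <= Rr -> AD_regular (ln (k%:R : R) / ln (n%:R : R)) (Num.sqrt Rr) (k ^ 3)%:R s ->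
    cintegrable F ->
    fsupp_in F (parab_nbhd (union_intervals s (Num.sqrt Rr)^-1) Rr^-1) ->
    (pnorm p F <= (K * Rr `^ eps * (size s)%:R `^ (2^-1 - 3 / p - c))%:E *
       poweR (\sum_(a <- s)
          (pnorm p (Fpiece F (parab_nbhd `[a, (a + (Num.sqrt Rr)^-1)%R] Rr^-1))
           * pnorm p (Fpiece F (parab_nbhd `[a, (a + (Num.sqrt Rr)^-1)%R] Rr^-1)))) 2^-1)%E) ->
  (forall a, a \in digit_words D j.+1 -> cintegrable (F a) /\ fsupp_in (F a) (theta a)) ->
  (pnorm p (csum (enum (word_class D j d)) F) <=
    (`|K| * (n%:R ^+ (2 * j.+1)) `^ eps * (k ^ j)%:R `^ (2^-1 - 3 / p - c) *
      (4 * multiplier_const R * pi ^+ 2))%:E *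
    poweR (\sum_(a in digit_words D j.+1) (pnorm p (F a) * pnorm p (F a))) 2^-1)%E.
Proof.
move=> k1 kn p1 Dk dD thm hF.
have n1 : (1 < n)%N by exact: ltn_trans kn.
set C := word_class D j d; set A := 4 * _ * _.
have A0 : 0 <= A by rewrite mulr_ge0 ?sqr_ge0// mulr_ge0 ?multiplier_const_ge0.
have CD b : b \in C -> b \in digit_words D j.+1 by rewrite inE => /andP[].
have sqrtE : Num.sqrt (n%:R ^+ (2 * j.+1)) = n%:R ^+ j.+1 :> R.
  by rewrite mulnC exprM sqrtr_sqr ger0_norm// exprn_ge0.
have iF : {in enum C, forall a, cintegrable (F a)} by move=> b; rewrite mem_enum => /CD /hF[].
have := thm (n%:R ^+ (2 * j.+1)) [seq cpt R a | a <- enum C] (csum (enum C) F).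
rewrite sqrtE => /(_ _ _ (cintegrable_csum iF))/wrap[||].
- by rewrite exprn_ege1// ler1n ltnW.
- exact: AD_regular_word_class.
move=> /(_ _)/wrap[|H].
  move=> xi nxi; rewrite ft_csum// /csum.
  have z a : a \in enum C -> ft (F a) xi = (0, 0).
    move=> aC; apply: (hF _ (CD _ _)).2; first by rewrite -mem_enum.
    move=> [x [t [xI [tn xiE]]]]; apply: nxi; exists x, t; split => //.
    by exists (cpt R a); [exact: map_f|move: xI; rewrite /= in_itv].
  by rewrite !big1_seq// => a /andP[_ /z ->].
apply: (le_trans H); rewrite big_map big_enum/= size_map -cardE card_word_class// Dk.
apply: (@le_trans _ _ ((`|K| * (n%:R ^+ (2 * j.+1)) `^ eps * (k ^ j)%:R `^ (2^-1 - 3 / p - c))%:E *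
    (A%:E * poweR (\sum_(a in C) (pnorm p (F a) * pnorm p (F a))) 2^-1))%E).
  apply: (@le_trans _ _ ((`|K| * (n%:R ^+ (2 * j.+1)) `^ eps * (k ^ j)%:R `^ (2^-1 - 3 / p - c))%:E *
    poweR (\sum_(a in C) (pnorm p (Fpiece (csum (enum C) F) (theta a)) *
      pnorm p (Fpiece (csum (enum C) F) (theta a)))) 2^-1)%E).
    (* The sign of [K] is unknown; its absolute value makes the prefactor nonnegative for the
       monotonicity steps that follow. *)
    apply: lee_wpmul2r; first exact: poweR_ge0.
    by rewrite lee_fin !ler_wpM2r ?powR_ge0// ler_norm.
  apply: lee_wpmul2l; first by rewrite lee_fin !mulr_ge0 ?powR_ge0.
  apply: poweR_sqrt_scale => // [a|a|a aC]; rewrite ?pnorm_ge0//.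
  rewrite (Fpiece_csum n1 k1 kn Dk hF aC); apply: pnorm_ift_ft_le => //.
    by case: (hF _ (CD _ aC)).
  move=> xi nxi; apply: (hF _ (CD _ aC)).2 => /(theta_box n1 (CD _ aC)); exact: nxi.
rewrite muleA -EFinM; apply: lee_wpmul2l; first by rewrite lee_fin mulr_ge0// !mulr_ge0 ?powR_ge0.
(* The sum over the class is enlarged to all words, so that every [d] gets the same right-hand
   side. *)
apply: gt0_ler_poweR => //.
- by rewrite in_itv/= leey andbT; apply: sume_ge0 => a _; rewrite mule_ge0 ?pnorm_ge0.
- by rewrite in_itv/= leey andbT; apply: sume_ge0 => a _; rewrite mule_ge0 ?pnorm_ge0.
by apply: lee_sum_nneg_subset => [a /CD//|a _]; rewrite mule_ge0 ?pnorm_ge0.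
Qed.

Theorem mainTheorem4 (R : realType) (n k : nat) (p c : R) :
  (2 <= k)%N -> (k < n)%N -> 6 < p -> 0 < c ->
  Thm11 p (ln (k%:R : R) / ln (n%:R : R)) c ->
  forall eps : R, 0 < eps ->
  exists C : R, forall (D : {set 'I_n}), #|D| = k ->
    forall i : nat, (1 <= i)%N ->
      (Dec p D i <= (C * (k%:R : R) `^ (i%:R * (2^-1 - 3 / p - c + eps)))%:E)%E.
Proof.
move=> k1 kn p6 _ thm eps eps0.
have n1 : (1 < n)%N by exact: ltn_trans kn.
have p1 : 1 < p by apply: lt_trans p6; rewrite ltr1n.
set al := ln _ / ln _ in thm; set ga := 2^-1 - 3 / p - c.
have k0 : (0 : R) < k%:R by rewrite ltr0n ltnW.
have al0 : 0 < al by rewrite divr_gt0// ln_gt0// ltr1n.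
have k31 : 1 <= (k ^ 3)%:R :> R by rewrite ler1n expn_gt0 ltnW.
(* With $R=n^{2i}$ and $n^\alpha=k$, this loss exponent turns the factor $R^{\alpha\epsilon/2}$ into
   $k^{i\epsilon}$. The regularity constant [k ^ 3] is common to all levels and digit sets, hence so
   is [K]. *)
have [K hK] := thm (k ^ 3)%:R (al * (eps / 2)) k31 (mulr_gt0 al0 (divr_gt0 eps0 (ltr0Sn R 1))).
pose A : R := 4 * multiplier_const R * pi ^+ 2.
have A0 : 0 <= A by rewrite mulr_ge0 ?sqr_ge0// mulr_ge0 ?multiplier_const_ge0.
(* The factor [k] counts the classes and [A] comes from the transform bound. The power [- ga]
   compensates for a class having $k^{i-1}$ words instead of $k^i$. The choice precedes [D], so the
   constant is uniform in the digit set. *)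
exists (k%:R * `|K| * k%:R `^ (- ga) * A) => D Dk [//|j] _.
pose B : R := k%:R * (`|K| * (n%:R ^+ (2 * j.+1)) `^ (al * (eps / 2)) * (k ^ j)%:R `^ ga * A).
have -> : k%:R * `|K| * k%:R `^ (- ga) * A * k%:R `^ (j.+1%:R * (ga + eps)) = B.
  rewrite /B; have -> : (n%:R ^+ (2 * j.+1)) `^ (al * (eps / 2)) = k%:R `^ (j.+1%:R * eps).
    rewrite powRrM -natrX powR_dim// natrX -powR_mulrn ?ltW// -powRrM; congr (_ `^ _).
    by rewrite natrM; field.
  have -> : (k ^ j)%:R `^ ga = k%:R `^ (j%:R * ga) by rewrite natrX -powR_mulrn ?ltW// -powRrM.
  rewrite (_ : j.+1%:R * (ga + eps) = j.+1%:R * eps + (j%:R * ga + ga)); last first.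
    by rewrite -natr1; ring.
  rewrite powRD ?(gt_eqF k0) ?implybT// powRD ?(gt_eqF k0) ?implybT//.
  have kga : k%:R `^ (- ga) * k%:R `^ ga = 1 :> R by rewrite -powRD ?(gt_eqF k0) ?implybT// addNr powRr0.
  transitivity (k%:R * (`|K| * k%:R `^ (j.+1%:R * eps) * k%:R `^ (j%:R * ga) * A) *
    (k%:R `^ (- ga) * k%:R `^ ga)); first by ring.
  by rewrite kga mulr1.
(* [Dec] is an infimum, so a single admissible constant bounds it. *)
apply: ereal_inf_lbound; exists B => //; split.
  by rewrite /B mulr_ge0// mulr_ge0// !mulr_ge0 ?powR_ge0.
move=> F hF.
(* The words are grouped by their last digit. *)
have -> : (fun x => ((\sum_(a in digit_words D j.+1) (F a x).1)%R,
      (\sum_(a in digit_words D j.+1) (F a x).2)%R)) =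
    csum (enum D) (fun d => csum (enum (word_class D j d)) F).
  apply/funext => x; rewrite /csum/= !big_enum/=; congr (_, _).
    rewrite (partition_big (fun a : {ffun 'I_j.+1 -> 'I_n} => a ord_max) (mem D))/=; last first.
      by move=> a; rewrite inE => /forallP.
    by apply: eq_bigr => d _; rewrite big_enum/=; apply: eq_bigl => a; rewrite word_classE.
  rewrite (partition_big (fun a : {ffun 'I_j.+1 -> 'I_n} => a ord_max) (mem D))/=; last first.
    by move=> a; rewrite inE => /forallP.
  by apply: eq_bigr => d _; rewrite big_enum/=; apply: eq_bigl => a; rewrite word_classE.
apply: (le_trans (pnorm_csum_le (ltW p1) _)).
  move=> d _; apply: cintegrable_csum => a; rewrite mem_enum inE => /andP[aD _].
  by case: (hF _ aD).
set Q := poweR _ _.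
(* Each class is bounded by the same multiple of [Q], so adding them up only costs the factor
   [k]. *)
apply: (@le_trans _ _ (\sum_(d <- enum D) ((`|K| * (n%:R ^+ (2 * j.+1)) `^ (al * (eps / 2)) *
    (k ^ j)%:R `^ ga * A)%:E * Q))%E).
  rewrite !big_enum; apply: lee_sum => d dD.
  exact: (class_decoupling k1 kn p1 Dk dD hK hF).
by rewrite big_enum/= sumr_const Dk /B [in leRHS]EFinM -[leRHS]muleA mule_natl.
Qed.
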